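(* Let $N\ge 4$, let $\mathbf{q}^e=(\mathbf{x}^e,\mathbf{y}^e)\in\mathbb{R}^{2N}$ be a placement of $N$ pairwise distinct nodes in the plane that do not all lie on a line, and let $\nu>0$. Let the stresses $\omega_{ij}$, the spring constants $k_{ij}=\alpha_{ij}\omega_{ij}$ and the rest lengths $l_{ij}$ be constructed from $\mathbf{q}^e$ as in the context. Then $[\mathbf{z}^e]=([\mathbf{q}^e],\mathbf{0},\mathbf{0})$ is a locally exponentially stable equilibrium set of the system $$\dot x_i=p^x_i,\quad \dot y_i=p^y_i,\quad \dot p^x_i=-\nu p^x_i-\frac{\partial \tilde V}{\partial x_i},\quad \dot p^y_i=-\nu p^y_i-\frac{\partial\tilde V}{\partial y_i},\qquad i=1,\dots,N.$$
   Context: A placement is $\mathbf{q}=(\mathbf{x},\mathbf{y})\in\mathbb{R}^{2N}$ with $\mathbf{x}=(x_1,\dots,x_N)^T$, $\mathbf{y}=(y_1,\dots,y_N)^T$; node $i$ is at $\vec q_i=(x_i,y_i)$, and $r_{ij}=\|\vec q_i-\vec q_j\|$. Momenta are $\mathbf{p}^x=(p^x_1,\dots,p^x_N)$ and $\mathbf{p}^y=(p^y_1,\dots,p^y_N)$, and the state is $\mathbf{z}=(\mathbf{q},\mathbf{p}^x,\mathbf{p}^y)\in\mathbb{R}^{4N}$. The system is considered where all $r_{ij}>0$ ($i\ne j$). The shape $[\mathbf{q}^e]$ is the set of all placements obtained from $\mathbf{q}^e$ by applying one rigid motion of $SE(2)$ (a rotation followed by a translation, no reflections) simultaneously to all $N$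 nodes, keeping the labels. $[\mathbf{z}^e]=([\mathbf{q}^e],\mathbf{0},\mathbf{0})=\{(\mathbf{q},\mathbf{0},\mathbf{0}):\mathbf{q}\in[\mathbf{q}^e]\}$. A set $S$ of equilibria is locally exponentially stable if there are $\delta,C,\lambda>0$ such that every solution with $\mathrm{dist}(\mathbf{z}(0),S)<\delta$ exists for all $t\ge0$ and satisfies $\mathrm{dist}(\mathbf{z}(t),S)\le Ce^{-\lambda t}\,\mathrm{dist}(\mathbf{z}(0),S)$ for all $t\ge 0$ (Euclidean distance). Construction of the parameters. Since the nodes of $\mathbf{q}^e$ are not collinear, $\mathbf{x}^e,\mathbf{y}^e,\mathbf{1}=(1,\dots,1)^T$ are linearly independent. Let $(\mathbf{v}_1,\dots,\mathbf{v}_N)$ be any orthonormal basis of $\mathbb{R}^N$ with $\mathrm{span}\{\mathbf{v}_1,\mathbf{v}_2,\mathbf{v}_3\}=\mathrm{span}\{\mathbf{x}^e,\mathbf{y}^e,\mathbf{1}\}$, let $\Lambda=(\mathbf{v}_1\cdots\mathbf{v}_N)$ and $D=\mathrm{diag}(0,0,0,d_4,\dots,d_N)$ with arbitrary $d_i>0$. The stress matrix is $\Omega=\Lambda D\Lambda^T$, and the stresses are $\omega_{ij}=-\Omega_{ij}$ for $i\neq j$ (so $\Omega_{ii}=\sum_{j\ne i}\omega_{ij}$). With $r^e_{ij}$ the value of $r_{ij}$ at $\mathbf{q}^e$, set, for $i\neq j$, $$\alpha_{ij}=\frac{\pi}{\arctan\omega_{ij}},\qquad l_{ij}=r^e_{ij}\Bigl(1-\frac1\pi\arctan\omega_{ij}\Bigr),$$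 and $k_{ij}=\alpha_{ij}\omega_{ij}=\pi\omega_{ij}/\arctan\omega_{ij}$, understood as its smooth extension $k_{ij}=\pi$ when $\omega_{ij}=0$. The potential is $$\tilde V(\mathbf{q})=\frac12\sum_{i<j}k_{ij}(r_{ij}-l_{ij})^2 .$$ *)

(* Defs.v *)
From HB Require Import structures.
From mathcomp Require Import all_boot all_order all_algebra.
From mathcomp Require Import all_classical all_reals all_analysis.

Set Implicit Arguments.
Unset Strict Implicit.
Unset Printing Implicit Defensive.
Import Order.TTheory GRing.Theory Num.Theory.
Import numFieldNormedType.Exports.

Local Open Scope classical_set_scope.
Local Open Scope ring_scope.

Section Placements.
Context {R : realType} {N : nat}.

(* [(x, y)], the vectors of abscissas and of ordinates of the N nodes *)
Definition placement : Type := ('cV[R]_N * 'cV[R]_N)%type.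

Definition node (q : placement) (i : 'I_N) : R * R := (q.1 i 0, q.2 i 0).

Definition edge_length (q : placement) (i j : 'I_N) : R :=
  Num.sqrt ((q.1 i 0 - q.1 j 0) ^+ 2 + (q.2 i 0 - q.2 j 0) ^+ 2).

Definition collinear (q : placement) : Prop :=
  exists a b c : R, (a, b) != (0, 0) /\
    forall i : 'I_N, a * (node q i).1 + b * (node q i).2 = c.

Definition rigid_motion (theta a b : R) (q : placement) : placement :=
  (cos theta *: q.1 - sin theta *: q.2 + const_mx a,
   sin theta *: q.1 + cos theta *: q.2 + const_mx b).

Definition placement_shape (q : placement) : set placement :=
  [set q' | exists theta a b : R, q' = rigid_motion theta a b q].

End Placements.
Arguments placement : clear implicits.

Section Stress.
Context {R : realType} {N : nat}.

Definition orthonormal_basis (v : N.-tuple 'cV[R]_N) : Prop :=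
  basis_of fullv v /\
  forall i j : 'I_N, ((tnth v i)^T *m tnth v j) 0 0 = (i == j)%:R.

(* The indices of [v] start at 0: [take 3 v] is the list of the first three
   basis vectors. *)
Definition adapted_basis (qe : placement R N) (v : N.-tuple 'cV[R]_N) : Prop :=
  orthonormal_basis v /\
  <<take 3 v>>%VS = <<[:: qe.1; qe.2; const_mx 1]>>%VS.

Definition admissible_spectrum (d : 'rV[R]_N) : Prop :=
  forall i : 'I_N, if (i < 3)%N then d 0 i = 0 else 0 < d 0 i.

Definition stress_matrix (v : N.-tuple 'cV[R]_N) (d : 'rV[R]_N) : 'M[R]_N :=
  let L := \matrix_(i, j) tnth v j i 0 in L *m diag_mx d *m L^T.

(* Only meaningful for [i != j], as are [omega], [k] and [l] everywhere below. *)
Definition stress (Omega : 'M[R]_N) (i j : 'I_N) : R := - Omega i j.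

Definition alpha (omega : R) : R := pi / atan omega.

(* The map [omega |-> alpha omega * omega] has a removable singularity at 0,
   where its limit is pi. *)
Definition spring_constant (omega : R) : R :=
  if omega == 0 then pi else alpha omega * omega.

Definition rest_length (re omega : R) : R := re * (1 - atan omega / pi).

Definition spring_potential (k l : 'I_N -> 'I_N -> R) (q : placement R N) : R :=
  2^-1 * \sum_(i < N) \sum_(j < N | (i < j)%N)
            k i j * (edge_length q i j - l i j) ^+ 2.

Definition designed_potential (qe : placement R N) (Omega : 'M[R]_N) :
    placement R N -> R :=
  spring_potential
    (fun i j => spring_constant (stress Omega i j))
    (fun i j => rest_length (edge_length qe i j) (stress Omega i j)).

End Stress.

Section Dynamics.
Context {R : realType} {N : nat}.

(* [(q, px, py)] *)
Definition state : Type := (placement R N * 'cV[R]_N * 'cV[R]_N)%type.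

Definition state_domain : set state :=
  [set z | forall i j : 'I_N, i != j -> 0 < edge_length z.1.1 i j].

Definition partial_x (V : placement R N -> R) (q : placement R N) (i : 'I_N) : R :=
  'D_((delta_mx i 0, 0) : placement R N) V q.

Definition partial_y (V : placement R N -> R) (q : placement R N) (i : 'I_N) : R :=
  'D_((0, delta_mx i 0) : placement R N) V q.

Definition damped_field (nu : R) (V : placement R N -> R) (z : state) : state :=
  let: (q, px, py) := z in
  ((px, py),
   \col_i (- nu * px i 0 - partial_x V q i),
   \col_i (- nu * py i 0 - partial_y V q i)).

(* [z] solves [z' = f z] in the region [state_domain] on the time interval
   [0, T[ (T may be +oo), the derivative at 0 being one-sided. *)
Definition is_solution (f : state -> state) (T : \bar R) (z : R -> state) : Prop :=
  [/\ forall t : R, 0 <= t -> (t%:E < T)%E -> state_domain (z t),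
      h^-1 *: (z h - z 0) @[h --> 0^'+] --> f (z 0)
    & forall t : R, 0 < t -> (t%:E < T)%E -> is_derive t 1 z (f (z t))].

Definition equilibrium (f : state -> state) (z : state) : Prop :=
  state_domain z /\ f z = 0.

(* The library norm on matrices and on products is the sup norm. *)
Definition euclidean_norm (z : state) : R :=
  let: ((x, y), px, py) := z in
  Num.sqrt (\sum_(i < N)
    (x i 0 ^+ 2 + y i 0 ^+ 2 + px i 0 ^+ 2 + py i 0 ^+ 2)).

Definition dist (z : state) (S : set state) : R :=
  inf [set euclidean_norm (z - s) | s in S].

(* "Every solution starting near S exists for all t >= 0": from each initial
   state [z0] near S there starts a solution [z] on [0, +oo[, and any solution
   from [z0] on some [0, T[ is a restriction of [z]. *)
Definition locally_exponentially_stable (f : state -> state) (S : set state) :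
    Prop :=
  exists delta C lambda : R, [/\ 0 < delta, 0 < C, 0 < lambda &
    forall z0 : state, state_domain z0 -> dist z0 S < delta ->
    exists z : R -> state,
      [/\ is_solution f +oo%E z,
          z 0 = z0,
          (forall (T : \bar R) (w : R -> state), is_solution f T w -> w 0 = z0 ->
             forall t : R, 0 <= t -> (t%:E < T)%E -> w t = z t)
        & forall t : R, 0 <= t ->
            dist (z t) S <= C * expR (- lambda * t) * dist z0 S]].

Definition locally_exponentially_stable_equilibrium_set
    (f : state -> state) (S : set state) : Prop :=
  (forall z : state, S z -> equilibrium f z) /\
  locally_exponentially_stable f S.

Definition rest_states (Q : set (placement R N)) : set state :=
  [set z | exists2 q : placement R N, Q q & z = (q, 0, 0)].

End Dynamics.
Arguments state : clear implicits.

(* Main.v *)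
Require Import Defs.
From mathcomp Require Import all_boot all_order all_algebra.
From mathcomp Require Import all_classical all_reals all_analysis.
From mathcomp Require Import ring lra.
Import Order.TTheory GRing.Theory Num.Theory.
Import numFieldNormedType.Exports.
Set Implicit Arguments.
Unset Strict Implicit.
Unset Printing Implicit Defensive.
Local Open Scope classical_set_scope.
Local Open Scope ring_scope.

(** Write [k l = (k - omega) r^e]. Up to an additive constant, the potential is
    [(x^T Omega x + y^T Omega y) / 2 + sum_(i < j) (k - omega) (r - r^e)^2 / 2],
    a sum of nonnegative terms because [k - omega > 0]. Its Hessian at [q^e]
    vanishes only on [h] with [Omega h = 0], i.e. [h] affine in the positions,
    and with no first order change of any length; three noncollinear nodes then
    force [h] to be an infinitesimal rigid motion. Aligning a placement with the
    nearest point of the shape turns this nondegeneracy into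
    [dist^2 <= C |grad V|^2] near the shape. With [p . grad V] as cross term,
    [|p|^2 / 2 + V - V(q^e) + eps p . grad V] is comparable to [dist^2] and decays
    exponentially as long as the trajectory stays near the shape, which it then
    does for all times. Solutions exist globally because truncating the lengths
    from below makes the field globally Lipschitz without changing it near the
    shape. *)

(** * Real analysis and ordinary differential equations *)

(** The shape is an unbounded family of equilibria along which the Hessian degenerates, so neither
    linearization at a point nor compactness yields uniform constants. Edge lengths are invariant
    under rigid motions and the gradient turns with the placement; hence the local estimates are
    made once, at [q^e], for the displacement [h] left after the optimal alignment. Optimality of
    the alignment says precisely that [h] is orthogonal to the infinitesimal rigid motions.

    The parameters are such that a spring of length [r^e] has stress [k (1 - l / r^e) = omega]; and
    [k - omega > 0] for both signs of [omega], because [arctan omega] has the sign of [omega] and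
    stays below [pi].

    The mechanical energy loses only [nu |p|^2]. The cross term contributes [- eps |grad V|^2],
    which is why distances have to be bounded by the gradient; this follows from a lower bound
    [c |h|^2] for [h . grad V(q^e + h)].

    The decay estimate presupposes that the trajectory stays near the shape, and staying near is
    deduced from the decay: a continuity argument in time breaks the circle. *)

Section Calculus.
Context {R : realType}.
Implicit Types (f g : R -> R) (t : R).

Lemma is_derive_eqfun f g t df dg : is_derive t 1 f df -> f =1 g -> df = dg ->
  is_derive t 1 g dg.
Proof. by move=> D /funext <- <-. Qed.

Lemma is_derive_const (c t : R) : is_derive t 1 (fun=> c) 0.
Proof. exact: is_derive_cst. Qed.

Lemma is_derive_add f g t df dg : is_derive t 1 f df -> is_derive t 1 g dg ->
  is_derive t 1 (fun s => f s + g s) (df + dg).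
Proof. exact: is_deriveD. Qed.

Lemma is_derive_sub f g t df dg : is_derive t 1 f df -> is_derive t 1 g dg ->
  is_derive t 1 (fun s => f s - g s) (df - dg).
Proof. exact: is_deriveB. Qed.

Lemma is_derive_scale (c : R) f t df : is_derive t 1 f df ->
  is_derive t 1 (fun s => c * f s) (c * df).
Proof. exact: is_deriveZ. Qed.

Lemma is_derive_mul f g t df dg : is_derive t 1 f df -> is_derive t 1 g dg ->
  is_derive t 1 (fun s => f s * g s) (df * g t + f t * dg).
Proof.
move=> Df Dg; apply: (is_derive_eqfun (is_deriveM Df Dg)) => //.
by rewrite /GRing.scale/=; ring.
Qed.

Lemma is_derive_sqr f t df : is_derive t 1 f df ->
  is_derive t 1 (fun s => f s ^+ 2) (2 * f t * df).
Proof.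
move=> D; have := is_deriveM D D.
rewrite [_ + _](_ : _ = 2 * f t * df) // /GRing.scale/=; ring.
Qed.

Lemma is_derive_div f g t df dg : is_derive t 1 f df -> is_derive t 1 g dg ->
  g t != 0 -> is_derive t 1 (fun s => f s / g s) (df / g t - f t * dg / g t ^+ 2).
Proof.
move=> Df Dg g0; apply: (is_derive_eqfun (is_derive_mul Df (is_deriveV g0 Dg))) => //.
by rewrite /GRing.scale/=; field.
Qed.

Lemma is_derive_bigsum (I : finType) (P : pred I) (h : I -> R -> R) (dh : I -> R) t :
  (forall i, P i -> is_derive t 1 (h i) (dh i)) ->
  is_derive t 1 (fun s => \sum_(i | P i) h i s) (\sum_(i | P i) dh i).
Proof.
move=> H.
have -> : (fun s => \sum_(i | P i) h i s) = \sum_(i | P i) h i.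
  by apply/funext => s; rewrite fct_sumE.
elim/big_ind2 : _ => // [|f df g dg Df Dg]; first exact: is_derive_cst.
exact: is_deriveD.
Qed.

End Calculus.

Section RealAnalysis.
Context {R : realType}.
Implicit Types f g u : R -> R.

Lemma is_derive_continuous f (df t : R) : is_derive t 1 f df ->
  {for t, continuous f}.
Proof. by move=> [+ _] => /derivable1_diffP/differentiable_continuous. Qed.

(** Integrating from [-1] makes [0] an interior point, so that the derivative there is two-sided, as
    [is_derive] demands. *)
Lemma antiderivative f : continuous f ->
  exists F : R -> R, F 0 = 0 /\ forall t : R, -1 < t -> is_derive t 1 F (f t).
Proof.
move=> cf.
pose I y := \int[lebesgue_measure]_(s in [set` `[-1, y]]) f s.
have dI (t : R) : -1 < t -> is_derive t 1 I (f t).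
  move=> t1.
  have [] := @continuous_FTC1_closed _ f (-1) t (t + 1) _ _ t1 (cf t).
  - by rewrite ltrDl.
  - apply: continuous_compact_integrable; first exact: segment_compact.
    exact: continuous_subspaceT.
  - by move=> dF eF; apply: (DeriveDef dF); rewrite -derive1E; exact: eF.
exists (fun t => I t - I 0); split=> [|t t1]; first by rewrite subrr.
have := is_deriveB (dI _ t1) (is_derive_cst (I 0) t 1).
by rewrite subr0.
Qed.

Lemma derive_ge0_le g (dg : R -> R) (a b : R) : a <= b ->
  (forall s, a < s < b -> is_derive s 1 g (dg s)) ->
  (forall s, a < s < b -> 0 <= dg s) ->
  {within `[a, b], continuous g} -> g a <= g b.
Proof.
rewrite le_eqVlt => /predU1P[->//|ab] dgs dg0 cg.
have D s : s \in `]a, b[ -> is_derive s 1 g (dg s).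
  by rewrite in_itv/=; exact: dgs.
have [c] := MVT ab D cg; rewrite in_itv/= => cab E.
by rewrite -subr_ge0 E mulr_ge0 ?dg0// subr_ge0 ltW.
Qed.

(** Both [phi - g] and [phi + g] are nondecreasing. This bounds Picard iterates by an explicit
    majorant without estimating integrals. *)
Lemma derive_bound g (dg : R -> R) phi (dphi : R -> R) (t : R) : 0 <= t ->
  (forall s, 0 <= s <= t -> is_derive s 1 g (dg s)) ->
  (forall s, 0 <= s <= t -> is_derive s 1 phi (dphi s)) ->
  (forall s, 0 <= s <= t -> `|dg s| <= dphi s) ->
  `|g t - g 0| <= phi t - phi 0.
Proof.
move=> t0 Dg Dphi le.
have W s : 0 < s < t -> 0 <= s <= t by case/andP=> ? ?; rewrite !ltW.
have key (e : R) : `|e| = 1 -> e * (g t - g 0) <= phi t - phi 0.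
  move=> e1.
  have D s : 0 <= s <= t ->
      is_derive s 1 (fun x => phi x - e *: g x) (dphi s - e *: dg s).
    move=> st; have := is_deriveB (Dphi _ st) (is_deriveZ e (Dg _ st)).
    exact.
  suff : phi 0 - e *: g 0 <= phi t - e *: g t.
    by rewrite /GRing.scale/= => H; lra.
  apply: (@derive_ge0_le (fun x => phi x - e *: g x)
            (fun s => dphi s - e *: dg s)) => //.
  - by move=> s /W; exact: D.
  - move=> s /W st; rewrite subr_ge0 (le_trans (ler_norm _))//.
    by rewrite /GRing.scale/= normrM e1 mul1r le.
  - apply: derivable_within_continuous => x; rewrite in_itv/= => /D.
    by case.
rewrite ler_norml; apply/andP; split.
  by have := key (-1); rewrite normrN normr1 => /(_ erefl); lra.
by have := key 1; rewrite normr1 => /(_ erefl); lra.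
Qed.

(** The function [u s * expR (- c * s)] is nonincreasing. The sign of [c] is free: the lemma serves
    uniqueness with a growth rate and the Lyapunov function with a decay rate. *)
Lemma gronwall u (du : R -> R) (c t : R) : 0 <= t ->
  (forall s, 0 < s < t -> is_derive s 1 u (du s)) ->
  (forall s, 0 < s < t -> du s <= c * u s) ->
  {within `[0, t], continuous u} ->
  u t <= u 0 * expR (c * t).
Proof.
move=> t0 Du le cu.
have De (s : R) : is_derive s 1 (fun x => expR (- c * x)) (expR (- c * s) * - c).
  apply: (@is_derive1_comp _ expR (fun x => - c * x)).
  have := is_deriveZ (- c) (is_derive_id s (1 : R)).
  by rewrite /GRing.scale/= mulr1.
have Dg s : 0 < s < t ->
    is_derive s 1 (fun x => - (u x * expR (- c * x)))
      (expR (- c * s) * (c * u s - du s)).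
  move=> st.
  apply: is_derive_eq; first by apply: is_deriveN; apply: is_deriveM; exact: Du.
  by rewrite /GRing.scale/=; ring.
have := derive_ge0_le t0 Dg.
rewrite mulr0 expR0 mulr1 lerN2 => H.
rewrite -(@ler_pM2r _ (expR (- c * t))) ?expR_gt0//.
rewrite -mulrA -expRD mulNr subrr expR0 mulr1 -mulNr.
apply: H.
  by move=> s st; rewrite mulr_ge0 ?expR_ge0// subr_ge0 le.
move=> x; apply: cvgN; apply: cvgM; first exact: cu.
move: x; apply: continuous_subspaceT => x.
exact: is_derive_continuous.
Qed.

(** Bootstrap: let [ts] be the infimum of the times at which [f] reaches [a]. Continuity gives
    [f <= a] up to [ts], the third hypothesis makes this strict at [ts], and continuity extends it
    beyond [ts], a contradiction. *)
Lemma trapping f (a : R) :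
  (forall t, 0 <= t -> {for t, continuous f}) -> f 0 < a ->
  (forall t, 0 <= t -> (forall s, 0 <= s <= t -> f s <= a) -> f t < a) ->
  forall t, 0 <= t -> f t < a.
Proof.
move=> cf f0 step t1 t10; rewrite ltNge; apply/negP => ft1.
pose S := [set t | 0 <= t /\ a <= f t].
have S0 : S !=set0 by exists t1.
have lbS : has_lbound S by exists 0 => s [].
have hS : has_inf S by split.
set ts := inf S.
have ts0 : 0 <= ts by apply: lb_le_inf => // s [].
have before s : 0 <= s -> s < ts -> f s < a.
  move=> s0 sts; rewrite ltNge; apply/negP => fs.
  by have := ge_inf lbS (conj s0 fs : S s); rewrite leNgt sts.
have near_ts e : 0 < e -> exists2 d, 0 < d &
    forall s, `|ts - s| < d -> `|f ts - f s| < e.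
  move=> e0; have /cvgrPdist_lt/(_ _ e0)[d /= d0 H] := cf _ ts0.
  by exists d => // s sd; apply: H.
have fts : f ts <= a.
  rewrite leNgt; apply/negP => afts.
  have [|d d0 H] := near_ts (f ts - a); first by rewrite subr_gt0.
  move: ts0; rewrite le_eqVlt => /predU1P[ts0|ts0].
    by move: f0 afts; rewrite ts0 => /lt_trans h /h; rewrite ltxx.
  pose s := Num.max 0 (ts - d / 2).
  have s0 : 0 <= s by rewrite le_max lexx.
  have sts : s < ts by rewrite gt_max ts0/=; lra.
  have /H : `|ts - s| < d.
    rewrite gtr0_norm ?subr_gt0// ltrBlDr -ltrBlDl lt_max.
    by apply/orP; right; lra.
  rewrite ltr_norml => /andP[_]; have := before _ s0 sts; lra.
have : f ts < a.
  apply: step => // s /andP[s0]; rewrite le_eqVlt => /predU1P[->//|].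
  by move/(before _ s0)/ltW.
move=> fa; have [|d d0 H] := near_ts (a - f ts); first by rewrite subr_gt0.
have [s [s0 fs] ss] := inf_adherent d0 hS.
have ts_s : ts <= s by apply: ge_inf.
have /H : `|ts - s| < d.
  by rewrite distrC ger0_norm ?subr_ge0// ltrBlDl.
by rewrite ltr_norml => /andP[+ _]; lra.
Qed.

Lemma geometric_cauchy (v : nat -> R) (c : R) :
  (forall n, `|v n.+1 - v n| <= c / 2 ^+ n) ->
  exists l, forall n, `|v n - l| <= 2 * c / 2 ^+ n.
Proof.
move=> H.
have c0 : 0 <= c by have := H 0%N; rewrite expr0 divr1; apply: le_trans.
(* The exact partial sum of the geometric series makes the induction on [k] close. *)
have dist n k : `|v (n + k)%N - v n| <= 2 * c / 2 ^+ n * (1 - 2^-1 ^+ k).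
  elim: k => [|k IH]; first by rewrite addn0 subrr normr0 expr0 subrr mulr0.
  rewrite addnS -(subrKA (v (n + k)%N)) (le_trans (ler_normD _ _))//.
  apply: (le_trans (lerD (H _) IH)).
  rewrite exprD invfM exprS -exprVn mulrA le_eqVlt; apply/orP; left; apply/eqP.
  by rewrite -exprVn; field.
have dist' n m : (n <= m)%N -> `|v m - v n| <= 2 * c / 2 ^+ n.
  move=> nm; rewrite -(subnKC nm); apply: (le_trans (dist _ _)).
  apply: ler_piMr; first by rewrite !mulr_ge0// invr_ge0 exprn_ge0.
  by rewrite lerBlDr lerDl exprn_ge0// invr_ge0.
have geo : (fun n => 2 * c / 2 ^+ n) @ \oo --> (0 : R).
  have := @cvg_geometric _ (2 * c) (2^-1 : R).
  rewrite ger0_norm ?invr_ge0// invf_lt1// ltr1n => /(_ erefl).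
  by apply: cvg_trans; under eq_fun do rewrite -exprVn.
have cv : cvgn v.
  apply: cauchy_cvg; apply/cauchy_ballP => e e0.
  have /cvgrPdist_lt/(_ (e / 2)) := geo.
  rewrite divr_gt0// => /(_ isT)[n _ Hn].
  have Hn' m : (n <= m)%N -> `|v n - v m| < e / 2.
    move=> nm; rewrite distrC; apply: (le_lt_trans (dist' _ _ nm)).
    have := Hn n (leqnn n); rewrite sub0r normrN; apply: le_lt_trans.
    exact: ler_norm.
  exists (v @` [set m | (n <= m)%N], v @` [set m | (n <= m)%N]) => /=.
    by split; exists n => // m /= nm; exists m.
  case=> _ _ /= [[i ni <-] [j nj <-]].
  rewrite /ball/= -(subrKA (v n)) (le_lt_trans (ler_normD _ _))//.
  by rewrite (splitr e) ltrD ?Hn'// distrC Hn'.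
exists (limn v) => n; rewrite distrC.
have cvd : (fun m => `|v m - v n|) @ \oo --> `|limn v - v n|.
  by apply: cvg_norm; apply: cvgB => //; exact: cvg_cst.
apply: (cvgr_to_le cvd).
by exists n => // m /= nm; exact: dist'.
Qed.

End RealAnalysis.

(** * Existence and uniqueness for Lipschitz fields *)

Section ODE.
Context {R : realType} {I : finType}.

(** Gronwall's lemma for the sum [u] of the squared differences. The Lipschitz bound is required
    only along the two solutions, so the field may be singular elsewhere. *)
Lemma ode_unique (z w dz dw : R -> I -> R) (L t : R) : 0 <= t ->
  (forall i, {within `[0, t], continuous (z^~ i)}) ->
  (forall i, {within `[0, t], continuous (w^~ i)}) ->
  (forall s i, 0 < s < t -> is_derive s 1 (z^~ i) (dz s i)) ->
  (forall s i, 0 < s < t -> is_derive s 1 (w^~ i) (dw s i)) ->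
  (forall s (M : R), 0 < s < t -> (forall i, `|w s i - z s i| <= M) ->
     forall i, `|dw s i - dz s i| <= L * M) ->
  (forall i, w 0 i = z 0 i) -> forall i, w t i = z t i.
Proof.
move=> t0 cz cw Dz Dw lip w0.
pose u s := \sum_i (w s i - z s i) ^+ 2.
pose du s := \sum_i 2 * (w s i - z s i) * (dw s i - dz s i).
have u_ge0 s : 0 <= u s by apply: sumr_ge0 => i _; exact: sqr_ge0.
have le_u s i : `|w s i - z s i| <= Num.sqrt (u s).
  rewrite -sqrtr_sqr ler_wsqrtr// /u (bigD1 i)//= lerDl.
  by apply: sumr_ge0 => j _; exact: sqr_ge0.
have : u t <= u 0 * expR (2 * L * #|I|%:R * t).
  apply: (@gronwall _ u du) => //.
  - move=> s st; apply: is_derive_bigsum => i _.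
    have D := is_deriveB (Dw s i st) (Dz s i st).
    exact: (is_derive_sqr D).
  - move=> s st.
    have -> : 2 * L * #|I|%:R * u s = 2 * \sum_(i : I) L * u s.
      by rewrite sumr_const -mulr_natl; ring.
    rewrite mulr_sumr; apply: ler_sum => i _; rewrite -mulrA ler_pM2l//.
    apply: (le_trans (ler_norm _)); rewrite normrM.
    have -> : L * u s = Num.sqrt (u s) * (L * Num.sqrt (u s)).
      by rewrite mulrCA -expr2 sqr_sqrtr.
    by apply: ler_pM => //; apply: lip => // j; exact: le_u.
  - have -> : u = \sum_i (fun s => (w s i - z s i) ^+ 2).
      by apply/funext => s; rewrite fct_sumE.
    elim/big_ind : _ => [|f g cf cg|i _] x; first exact: cvg_cst.
      by apply: cvgD; [exact: cf|exact: cg].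
    by apply: cvgM; apply: cvgB; [exact: cw|exact: cz|exact: cw|exact: cz].
rewrite [u 0]big1 => [|i _]; last by rewrite w0 subrr expr0n.
rewrite mul0r => ut i; apply/eqP; rewrite -subr_eq0 -normr_le0.
apply: (le_trans (le_u t i)).
by rewrite (_ : u t = 0) ?sqrtr0//; apply/eqP; rewrite eq_le ut u_ge0.
Qed.

(** Successive approximations, measured with the weight [expR (2 * L * t)]: with it each step halves
    distances on the whole half-line at once, so the solution is global without gluing local
    ones. *)
Lemma picard (F : (I -> R) -> I -> R) (L : R) (z0 : I -> R) : 0 < L ->
  (forall a b (M : R), (forall i, `|a i - b i| <= M) ->
     forall i, `|F a i - F b i| <= L * M) ->
  exists z : R -> I -> R, z 0 = z0 /\
    forall (t : R) i, 0 <= t -> is_derive t 1 (z^~ i) (F (z t) i).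
Proof.
move=> L0 lip.
(* Evaluating at [clamp s] freezes the integrand before time [0]: it becomes continuous on the whole
   line, and its primitive is differentiable at [0] from both sides. *)
pose clamp (s : R) : R := Num.max s 0.
have clamp_ge (s : R) : 0 <= s -> clamp s = s by move=> s0; apply/max_idPl.
have clamp0 s : 0 <= clamp s by rewrite le_max lexx orbT.
have cclamp : continuous clamp.
  by move=> x; apply: continuous_max; [exact: cvg_id|exact: cvg_cst].
pose prim (f : R -> R) := match pselect (continuous f) with
  | left cf => sval (cid (antiderivative cf)) | right _ => cst 0 end.
have primP f : continuous f ->
    prim f 0 = 0 /\ forall t : R, -1 < t -> is_derive t 1 (prim f) (f t).
  move=> cf; rewrite /prim; case: pselect => // cf'.
  exact: svalP (cid (antiderivative cf')).
pose good (z : R -> I -> R) := forall i, continuous (fun s => z (clamp s) i).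
have goodF z : good z -> forall i, continuous (fun s => F (z (clamp s)) i).
  move=> gz i x; apply/cvgrPdist_le => e e0.
  have : \forall s \near x, forall j : I,
      `|z (clamp x) j - z (clamp s) j| <= e / L.
    apply: (@filter_forall _ _
      (fun j s => `|z (clamp x) j - z (clamp s) j| <= e / L) (nbhs x)) => j.
    have /cvgrPdist_le := gz j x.
    by move/(_ _ (divr_gt0 e0 L0)).
  apply: filterS => s /lip/(_ i)/le_trans; apply.
  by rewrite mulrC divfK// gt_eqF.
pose step (z : R -> I -> R) t i := z0 i + prim (fun s => F (z (clamp s)) i) t.
have step0 z : good z -> step z 0 = z0.
  by move=> /goodF gz; apply/funext => i; rewrite /step (primP _ (gz i)).1 addr0.
have Dstep z (t : R) i : good z -> 0 <= t ->
    is_derive t 1 ((step z)^~ i) (F (z t) i).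
  move=> /goodF gz t0; have t1 : -1 < t by apply: lt_le_trans t0; lra.
  have := is_deriveD (is_derive_cst (z0 i) t 1) ((primP _ (gz i)).2 t t1).
  by rewrite add0r clamp_ge.
have good_step z : good z -> good (step z).
  move=> gz i x; apply: (@continuous_comp _ _ _ clamp (fun s => step z s i)).
    exact: cclamp.
  by apply: is_derive_continuous; apply: Dstep.
pose zs n := iter n step (fun _ => z0).
have good_zs n : good (zs n).
  elim: n => [i x|n IH]; first exact: cvg_cst.
  by rewrite /zs iterS; exact: good_step.
have Dexp c (s : R) : is_derive s 1 (fun x => c * expR (2 * L * x))
    (c * (2 * L) * expR (2 * L * s)).
  have D1 := is_deriveZ (2 * L) (is_derive_id s (1 : R)).
  have D2 := @is_derive1_comp _ expR (fun x => 2 * L * x) s _ _ (is_derive_expR _) D1.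
  apply: (is_derive_eq (is_deriveZ c D2)).
  by rewrite /GRing.scale/=; ring.
have step_lip y z (c : R) : good y -> good z ->
    (forall t i, 0 <= t -> `|F (y t) i - F (z t) i| <= c * (2 * L) * expR (2 * L * t)) ->
    forall t i, 0 <= t -> `|step y t i - step z t i| <= c * expR (2 * L * t).
  move=> gy gz le t i t0.
  have c0 : 0 <= c.
    have := le_trans (normr_ge0 _) (le 0 i (lexx 0)).
    by rewrite pmulr_lge0 ?expR_gt0// pmulr_lge0// mulr_gt0.
  have := @derive_bound _ (fun s => step y s i - step z s i)
    (fun s => F (y s) i - F (z s) i) _ _ t t0 _ (fun s _ => Dexp c s) _.
  rewrite !step0// subrr subr0 mulr0 expR0 mulr1 => H.
  apply: (le_trans (H _ _)).
  - by move=> s /andP[s0 _]; apply: is_deriveB; exact: Dstep.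
  - by move=> s /andP[s0 _]; exact: le.
  - by rewrite gerBl.
pose K0 := \sum_i `|F z0 i|.
(* So that [K * (2 * L)] bounds every coordinate of the field at [z0], hence the growth of the first
   iterate. *)
pose K := K0 / (2 * L).
have K0_ge0 : 0 <= K0 by apply: sumr_ge0.
have K_ge0 : 0 <= K by rewrite divr_ge0// mulr_ge0// ltW.
have bound n t i : 0 <= t ->
    `|zs n.+1 t i - zs n t i| <= K / 2 ^+ n * expR (2 * L * t).
  elim: n t i => [|n IH] t i t0.
    rewrite /zs /= expr0 divr1 /step addrAC subrr add0r.
    have [p0 Dp] := primP _ (goodF _ (good_zs 0%N) i).
    have := @derive_bound _ (prim (fun=> F z0 i)) (fun=> F z0 i)
      _ _ t t0 _ (fun s _ => Dexp K s) _.
    rewrite p0 subr0 mulr0 expR0 mulr1 => H; apply: (le_trans (H _ _)).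
    - by move=> s /andP[s0 _]; apply: Dp; apply: lt_le_trans s0; lra.
    - move=> s /andP[s0 _]; rewrite divfK ?gt_eqF ?mulr_gt0//.
      apply: (@le_trans _ _ K0).
        by rewrite /K0 (bigD1 i)//= lerDl sumr_ge0.
      by rewrite ler_peMr// -expR0 ler_expR !mulr_ge0// ltW.
    - by rewrite gerBl divr_ge0// mulr_ge0// ltW.
  have -> : zs n.+2 = step (zs n.+1) by [].
  have -> : zs n.+1 = step (zs n) by [].
  apply: step_lip => //; [exact: good_step|] => s j s0.
  apply: (le_trans (lip _ _ _ (fun k => IH s k s0) j)).
  rewrite exprS invfM le_eqVlt; apply/orP; left; apply/eqP.
  by field; rewrite expf_neq0.
have lims (t : R) i : exists l, 0 <= t -> forall n,
    `|zs n t i - l| <= 2 * K / 2 ^+ n * expR (2 * L * t).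
  have [t0|t0] := leP 0 t; last by exists 0.
  have [|l Hl] := @geometric_cauchy _ (fun n => zs n t i) (K * expR (2 * L * t)).
    by move=> n; rewrite mulrAC; exact: bound.
  by exists l => _ n; rewrite mulrAC -[2 * K * _]mulrA; exact: Hl.
pose Z t i := sval (cid (lims t i)).
have ZP n t i : 0 <= t ->
    `|zs n t i - Z t i| <= 2 * K / 2 ^+ n * expR (2 * L * t).
  by move=> t0; exact: (svalP (cid (lims t i)) t0 n).
have geo (c e : R) : 0 < e -> exists n, c / 2 ^+ n <= e.
  move=> e0; have := @cvg_geometric _ c (2^-1 : R).
  rewrite ger0_norm ?invr_ge0// invf_lt1// ltr1n => /(_ erefl).
  move=> /cvgrPdist_le/(_ _ e0)[n _ /(_ n (leqnn n))]/=.
  rewrite sub0r normrN exprVn => H; exists n; apply: le_trans H.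
  exact: ler_norm.
have goodZ : good Z.
  move=> i x; apply/cvgrPdist_le => e e0.
  (* Up to time [clamp x + 1] the weight is at most [E], so convergence is uniform near [x]. *)
  pose E := expR (2 * L * (clamp x + 1)).
  have [|n Hn] := geo (2 * K * E) (e / 4); first by rewrite divr_gt0.
  have : \forall s \near x, `|clamp x - clamp s| < 1 /\
      `|zs n (clamp x) i - zs n (clamp s) i| <= e / 4.
    near=> s; split; near: s.
      by have /cvgrPdist_lt := cclamp x; apply.
    by have /cvgrPdist_le := good_zs n i x; apply; rewrite divr_gt0.
  have bnd s : `|clamp x - clamp s| < 1 ->
      `|zs n (clamp s) i - Z (clamp s) i| <= e / 4.
    move=> xs; apply: (le_trans (ZP n (clamp s) i _)) => //.
    apply: le_trans Hn; rewrite [leRHS]mulrAC ler_wpM2l//.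
      by rewrite divr_ge0 ?exprn_ge0// mulr_ge0.
    rewrite ler_expR ler_pM2l ?mulr_gt0//.
    by move: xs; rewrite ltr_norml => /andP[]; lra.
  apply: filterS => s [/bnd bs zss].
  have bx : `|zs n (clamp x) i - Z (clamp x) i| <= e / 4.
    by apply: bnd; rewrite subrr normr0.
  move: bs zss bx; rewrite !ler_norml => /andP[? ?] /andP[? ?] /andP[? ?].
  by apply/andP; split; lra.
have stepZ t : 0 <= t -> step Z t = Z t.
  move=> t0; apply/funext => i; apply/eqP; rewrite -subr_eq0 -normr_le0.
  apply/ler_addgt0Pl => e e0; rewrite addr0.
  have [|n Hn] := geo (2 * K * expR (2 * L * t)) (e / 2).
    by rewrite divr_gt0.
  have H1 : `|zs n.+1 t i - step Z t i| <= K / 2 ^+ n * expR (2 * L * t).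
    have -> : zs n.+1 = step (zs n) by [].
    apply: step_lip => // s j s0.
    apply: (le_trans (lip _ _ _ (fun k => ZP n s k s0) j)).
    by rewrite le_eqVlt; apply/orP; left; apply/eqP; ring.
  have H2 := ZP n.+1 t i t0.
  have E2 : 2 * K / 2 ^+ n.+1 * expR (2 * L * t) = K / 2 ^+ n * expR (2 * L * t).
    by rewrite exprS; field; rewrite expf_neq0.
  have E3 : 2 * K * expR (2 * L * t) / 2 ^+ n = 2 * (K / 2 ^+ n * expR (2 * L * t)).
    by field; rewrite expf_neq0.
  move: H1 H2 Hn; rewrite E2 E3 !ler_norml => /andP[? ?] /andP[? ?] ?.
  by apply/andP; split; lra.
(* [Z] is arbitrary at negative times; [step Z] agrees with it from [0] on and has a two-sided
   derivative at [0]. *)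
exists (step Z); split; first exact: step0.
by move=> t i t0; rewrite stepZ//; exact: Dstep.
Unshelve. all: by end_near. Qed.

End ODE.

(** * The stress matrix *)

(** Lagrange's identity: twice the difference of the two sides is a sum of squares of 2 x 2
    minors. *)
Lemma sum_cauchy_schwarz (R : realFieldType) (I : finType) (a b : I -> R) :
  (\sum_i a i * b i) ^+ 2 <= (\sum_i a i ^+ 2) * (\sum_i b i ^+ 2).
Proof.
rewrite -subr_ge0 -(@pmulr_rge0 _ 2)//.
suff -> : 2 * ((\sum_i a i ^+ 2) * (\sum_i b i ^+ 2) - (\sum_i a i * b i) ^+ 2) =
    \sum_i \sum_j (a i * b j - a j * b i) ^+ 2.
  by apply: sumr_ge0 => i _; apply: sumr_ge0 => j _; exact: sqr_ge0.
have E1 : (\sum_i a i ^+ 2) * (\sum_i b i ^+ 2) =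
    \sum_i \sum_j a i ^+ 2 * b j ^+ 2 by rewrite big_distrlr.
have E2 : (\sum_i a i ^+ 2) * (\sum_i b i ^+ 2) =
    \sum_i \sum_j a j ^+ 2 * b i ^+ 2 by rewrite E1 exchange_big.
have E3 : (\sum_i a i * b i) ^+ 2 = \sum_i \sum_j (a i * b i) * (a j * b j).
  by rewrite expr2 big_distrlr.
transitivity (\sum_i \sum_j a i ^+ 2 * b j ^+ 2 + \sum_i \sum_j a j ^+ 2 * b i ^+ 2
    + - 2 * \sum_i \sum_j (a i * b i) * (a j * b j)).
  by rewrite -E1 -E2 -E3; ring.
rewrite mulr_sumr -!big_split; apply: eq_bigr => i _.
by rewrite mulr_sumr -!big_split; apply: eq_bigr => j _ /=; ring.
Qed.

(** Quantitative injectivity without compactness: the matrix of the forms has a one-sided inverse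
    [B], which recovers [h] from the values of the forms, and the Cauchy-Schwarz inequality bounds
    the result by the sum of the squared entries of [B]. *)
Lemma linear_forms_bound (R : realFieldType) (J K : finType) (A : K -> J -> R) :
  (forall h, (forall k, \sum_j A k j * h j = 0) -> forall j, h j = 0) ->
  exists C : R, 0 < C /\
    forall h, \sum_j h j ^+ 2 <= C * \sum_k (\sum_j A k j * h j) ^+ 2.
Proof.
move=> inj.
have sum_enum (T : finType) (F : T -> R) :
    \sum_x F x = \sum_(i < #|T|) F (enum_val i).
  by rewrite -(big_enum_val F); exact: eq_bigl.
pose M : 'M[R]_(#|J|, #|K|) := \matrix_(j, k) A (enum_val k) (enum_val j).
have E (h : J -> R) k :
    ((\row_j h (enum_val j)) *m M) 0 k = \sum_j A (enum_val k) j * h j.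
  rewrite mxE [RHS]sum_enum.
  by apply: eq_bigr => j _; rewrite !mxE mulrC.
have : row_free M.
  apply: inj_row_free => u uM0; apply/rowP => j; rewrite mxE.
  have := inj (fun j => u 0 (enum_rank j)) _ (enum_val j).
  rewrite enum_valK; apply => k.
  rewrite -(enum_rankK k) -E.
  have -> : \row_j0 u 0 (enum_rank (enum_val j0)) = u.
    by apply/rowP => i; rewrite !mxE enum_valK.
  by rewrite uM0 mxE.
move=> /row_freeP[B MB].
pose C := \sum_j \sum_k B k j ^+ 2.
have C0 : 0 <= C.
  by apply: sumr_ge0 => j _; apply: sumr_ge0 => k _; exact: sqr_ge0.
(* The sum [C] may vanish, namely when [J] is empty. *)
exists (C + 1); split=> [|h]; first by rewrite ltr_wpDl.
pose u : 'rV[R]_#|J| := \row_j h (enum_val j).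
set S := \sum_k (\sum_j A k j * h j) ^+ 2.
have S0 : 0 <= S by apply: sumr_ge0 => k _; exact: sqr_ge0.
apply: (@le_trans _ _ (C * S)); last by rewrite ler_wpM2r// lerDl.
rewrite [leLHS]sum_enum /C mulr_suml.
apply: ler_sum => j _.
have -> : h (enum_val j) = \sum_k (u *m M) 0 k * B k j.
  have : (u *m M *m B) 0 j = u 0 j by rewrite -mulmxA MB mulmx1.
  by rewrite mxE [u 0 j]mxE => <-.
apply: (le_trans (sum_cauchy_schwarz _ _)); rewrite mulrC ler_wpM2l//.
  by apply: sumr_ge0 => k _; exact: sqr_ge0.
rewrite /S [leRHS]sum_enum.
by apply: ler_sum => k _; rewrite E.
Qed.

Section StressMatrix.
Context {R : realType} {N : nat} (qe : placement R N).
Context (v : N.-tuple 'cV[R]_N) (d : 'rV[R]_N).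
Hypothesis N_gt2 : (2 < N)%N.
Hypothesis basis_v : adapted_basis qe v.
Hypothesis spec_d : admissible_spectrum d.

Let L : 'M[R]_N := \matrix_(i, j) tnth v j i 0.
Let Om := stress_matrix v d.

Let LTL : L^T *m L = 1%:M.
Proof.
apply/matrixP => i j; have [[_ e] _] := basis_v.
rewrite !mxE -e mxE.
by apply: eq_bigr => k _; rewrite !mxE.
Qed.

Let LLT : L *m L^T = 1%:M.
Proof. exact: mulmx1C LTL. Qed.

Let OmE : Om = L *m diag_mx d *m L^T. Proof. by []. Qed.

Lemma stress_matrix_sym i j : Om i j = Om j i.
Proof.
suff e : Om^T = Om by rewrite -[in LHS]e mxE.
by rewrite OmE !trmx_mul trmxK tr_diag_mx mulmxA.
Qed.

Let d_ge0 k : 0 <= d 0 k.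
Proof. by have := spec_d k; case: ifP => _ => [->|/ltW]. Qed.

(** In the basis of eigenvectors this reads [d_k ^ 2 <= c * d_k]. The single inequality encodes
    semidefiniteness together with an upper bound on the spectrum, and later proofs use the stress
    matrix in this form. *)
Lemma stress_matrix_bound : exists c, 0 < c /\
  forall x : 'cV[R]_N, \sum_i (Om *m x) i 0 ^+ 2 <= c * \sum_i x i 0 * (Om *m x) i 0.
Proof.
exists (\sum_k d 0 k + 1); split=> [|x].
  by rewrite ltr_wpDl// sumr_ge0.
pose y := L^T *m x.
have xE : x = L *m y by rewrite /y mulmxA LLT mul1mx.
have OxE : Om *m x = L *m (diag_mx d *m y).
  by rewrite {1}xE OmE -!mulmxA [L^T *m _]mulmxA LTL mul1mx.
have dot (a b : 'cV[R]_N) :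
    \sum_i (L *m a) i 0 * (L *m b) i 0 = \sum_i a i 0 * b i 0.
  have tr (a' b' : 'cV[R]_N) : (a'^T *m b') 0 0 = \sum_i a' i 0 * b' i 0.
    by rewrite mxE; apply: eq_bigr => i _; rewrite mxE.
  by rewrite -!tr trmx_mul -mulmxA [L^T *m _]mulmxA LTL mul1mx.
rewrite OxE {1}xE; clearbody y.
under eq_bigr do rewrite expr2.
rewrite !dot mulr_sumr; apply: ler_sum => k _.
rewrite mul_diag_mx !mxE -mulrA (mulrCA (y k 0)) -expr2.
rewrite ler_wpM2r// ?(mulr_ge0 (d_ge0 k)) ?sqr_ge0//.
by rewrite (bigD1 k)//= -addrA lerDl addr_ge0 ?sumr_ge0.
Qed.

Let spanE (u : 'cV[R]_N) : (u \in <<take 3 v>>)%VS =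
  (u \in <<[:: qe.1; qe.2; const_mx 1]>>)%VS.
Proof. by have [_ e] := basis_v; rewrite e. Qed.

Let nth_take3 (k : nat) (Hk : (k < N)%N) : (k < 3)%N ->
  (take 3 v)`_k = tnth v (Ordinal Hk).
Proof. by move=> k3; rewrite nth_take// (tnth_nth 0). Qed.

Lemma stress_matrix_ker_sub (u : 'cV[R]_N) :
  (u \in <<[:: qe.1; qe.2; const_mx 1]>>)%VS -> Om *m u = 0.
Proof.
rewrite -spanE => /(@coord_span _ _ _ (in_tuple (take 3 v))) ->.
rewrite mulmx_sumr big1// => i _; rewrite -scalemxAr.
suff -> : Om *m (in_tuple (take 3 v))`_i = 0 by rewrite scaler0.
have i3 : (i < 3)%N.
  by rewrite (leq_trans (ltn_ord i))// size_take_min geq_minl.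
have iN := leq_trans i3 N_gt2.
rewrite /= (nth_take3 iN)//.
have -> : tnth v (Ordinal iN) = L *m delta_mx (Ordinal iN) 0.
  by rewrite -colE; apply/colP => j; rewrite !mxE.
rewrite OmE -!mulmxA [L^T *m _]mulmxA LTL mul1mx mul_diag_mx.
suff -> : \matrix_(i0, j) (d 0 i0 * (delta_mx (Ordinal iN) 0 : 'cV[R]_N) i0 j) = 0.
  by rewrite mulmx0.
apply/matrixP => a b; rewrite !mxE.
have [->|] := eqVneq a (Ordinal iN); last by rewrite mulr0.
by have := spec_d (Ordinal iN); rewrite /= i3 => ->; rewrite mul0r.
Qed.

(** Since [d] is positive from the fourth index on, only the first three coordinates of [u] in the
    basis [v] survive. *)
Lemma stress_matrix_ker (u : 'cV[R]_N) : Om *m u = 0 ->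
  exists a b c : R, forall i, u i 0 = a * qe.1 i 0 + b * qe.2 i 0 + c.
Proof.
move=> Ou0.
have dy0 : diag_mx d *m (L^T *m u) = 0.
  have : L^T *m (Om *m u) = 0 by rewrite Ou0 mulmx0.
  by rewrite OmE !mulmxA LTL mul1mx.
have uin : (u \in <<take 3 v>>)%VS.
  have -> : u = \sum_k (L^T *m u) k 0 *: tnth v k.
    rewrite -[LHS]mul1mx -LLT -mulmxA; apply/colP => i.
    rewrite mxE summxE; apply: eq_bigr => k _.
    by rewrite [L i k]mxE [RHS]mxE mulrC.
  apply: memv_suml => k _.
  have dyk : d 0 k * (L^T *m u) k 0 = 0.
    by have := congr1 (fun M : 'cV[R]_N => M k 0) dy0; rewrite mul_diag_mx !mxE.
  have := spec_d k; case: ifP => [k3 _|_ dk].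
    apply: memvZ; apply: memv_span.
    rewrite (_ : tnth v k = (take 3 v)`_k).
      by rewrite mem_nth// size_take_min size_tuple leq_min k3 ltn_ord.
    by rewrite (nth_take3 (ltn_ord k))//; congr tnth; apply: val_inj.
  move/eqP: dyk; rewrite mulf_eq0 gt_eqF//= => /eqP ->.
  by rewrite scale0r mem0v.
move: uin; rewrite spanE => /(@coord_span _ _ _ (in_tuple _)) uE.
exists (coord (in_tuple [:: qe.1; qe.2; const_mx 1]) ord0 u).
exists (coord (in_tuple [:: qe.1; qe.2; const_mx 1]) (lift ord0 ord0) u).
exists (coord (in_tuple [:: qe.1; qe.2; const_mx 1]) (lift ord0 (lift ord0 ord0)) u).
move=> i; rewrite [in LHS]uE !big_ord_recl big_ord0 /= !mxE.
by rewrite addr0 mulr1 addrA.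
Qed.

End StressMatrix.

(** * Geometry of placements *)

Section PlaneGeometry.
Context {R : realType}.
Implicit Types a b c d : R.

Definition norm2 a b : R := Num.sqrt (a ^+ 2 + b ^+ 2).

Lemma norm2_ge0 a b : 0 <= norm2 a b. Proof. exact: sqrtr_ge0. Qed.

Lemma sqr_norm2 a b : norm2 a b ^+ 2 = a ^+ 2 + b ^+ 2.
Proof. by rewrite sqr_sqrtr// addr_ge0 ?sqr_ge0. Qed.

Lemma norm2_le a b c : 0 <= c -> a ^+ 2 + b ^+ 2 <= c ^+ 2 -> norm2 a b <= c.
Proof.
move=> c0 H; rewrite -(@ler_pXn2r _ 2) ?nnegrE ?norm2_ge0//.
by rewrite sqr_norm2.
Qed.

Lemma normr_le_norm2l a b : `|a| <= norm2 a b.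
Proof. by rewrite -sqrtr_sqr ler_wsqrtr// lerDl sqr_ge0. Qed.

Lemma norm2C a b : norm2 a b = norm2 b a.
Proof. by rewrite /norm2 addrC. Qed.

Lemma normr_le_norm2r a b : `|b| <= norm2 a b.
Proof. by rewrite norm2C normr_le_norm2l. Qed.

Lemma norm2_eq0 a b : norm2 a b = 0 -> a = 0 /\ b = 0.
Proof.
move=> e; split; apply/eqP; rewrite -normr_le0 -e.
  exact: normr_le_norm2l.
exact: normr_le_norm2r.
Qed.

Lemma norm2_gt0 a b : (0 < norm2 a b) = (0 < a ^+ 2 + b ^+ 2).
Proof. by rewrite /norm2 sqrtr_gt0. Qed.

Lemma dot_le_norm2 a b c d : a * c + b * d <= norm2 a b * norm2 c d.
Proof.
apply: (le_trans (ler_norm _)).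
rewrite -(@ler_pXn2r _ 2) ?nnegrE ?mulr_ge0 ?norm2_ge0//.
rewrite exprMn !sqr_norm2 real_normK ?num_real// -subr_ge0.
rewrite (_ : _ - _ = (a * d - b * c) ^+ 2); first exact: sqr_ge0.
by ring.
Qed.

Lemma norm2D a b c d : norm2 (a + c) (b + d) <= norm2 a b + norm2 c d.
Proof.
apply: norm2_le; first by rewrite addr_ge0 ?norm2_ge0.
rewrite [leRHS]sqrrD !sqr_norm2; have := dot_le_norm2 a b c d; lra.
Qed.

Lemma norm2N a b : norm2 (- a) (- b) = norm2 a b.
Proof. by rewrite /norm2 !sqrrN. Qed.

Lemma norm2_dist a b c d : `|norm2 a b - norm2 c d| <= norm2 (a - c) (b - d).
Proof.
have := norm2D (a - c) (b - d) c d; have := norm2D (c - a) (d - b) a b.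
rewrite !subrK -[norm2 (c - a) _]norm2N !opprB ler_norml => H1 H2.
by apply/andP; split; lra.
Qed.

Lemma norm2_le_normD a b : norm2 a b <= `|a| + `|b|.
Proof.
apply: norm2_le; first by rewrite addr_ge0.
by rewrite sqrrD !real_normK ?num_real// lerD2r lerDl mulrn_wge0// mulr_ge0.
Qed.

End PlaneGeometry.

Section Statics.
Context {R : realType} {N : nat}.
Implicit Types (x y w : 'I_N -> R) (c om kap re : 'I_N -> 'I_N -> R).

(** The graph Laplacian with weights [c]. The term [j = i] vanishes, so weights that are meaningful
    only off the diagonal, such as [stress], can be used as they are. *)
Definition lap c x i : R := \sum_j c i j * (x i - x j).

Definition len x y i j : R := norm2 (x i - x j) (y i - y j).

(* Weighting the graph Laplacian by [tension] gives the gradient of the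
   potential; [rho i j] stands for the length of the edge [i j], possibly
   truncated from below. *)
Definition tension om kap re (rho : 'I_N -> 'I_N -> R) i j : R :=
  om i j + kap i j * (1 - re i j / rho i j).

Definition sqnorm x y : R := \sum_i (x i ^+ 2 + y i ^+ 2).

Lemma sqnorm_ge0 x y : 0 <= sqnorm x y.
Proof. by apply: sumr_ge0 => i _; rewrite addr_ge0 ?sqr_ge0. Qed.

Lemma le_sqnorm x y i : x i ^+ 2 + y i ^+ 2 <= sqnorm x y.
Proof.
rewrite /sqnorm (bigD1 i)//= lerDl; apply: sumr_ge0 => j _.
by rewrite addr_ge0 ?sqr_ge0.
Qed.

Lemma sqnorm_diff x y i j :
  (x i - x j) ^+ 2 + (y i - y j) ^+ 2 <= 4 * sqnorm x y.
Proof.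
have := le_sqnorm x y i; have := le_sqnorm x y j.
have := sqr_ge0 (x i + x j); have := sqr_ge0 (y i + y j).
by lra.
Qed.

Lemma len_sym x y i j : len x y i j = len x y j i.
Proof. by rewrite /len -norm2N !opprB. Qed.

Lemma len_diag x y i : len x y i i = 0.
Proof. by rewrite /len /norm2 !subrr expr0n addr0 sqrtr0. Qed.

Lemma lap_linear c (a b k : R) x y i :
  lap c (fun j => a * x j + b * y j + k) i = a * lap c x i + b * lap c y i.
Proof.
by rewrite /lap !mulr_sumr -big_split/=; apply: eq_bigr => j _; ring.
Qed.

Lemma lapD c x y i : lap c (fun j => x j + y j) i = lap c x i + lap c y i.
Proof. by rewrite /lap -big_split/=; apply: eq_bigr => j _; ring. Qed.

Lemma lapDl c om x i : lap (fun i j => c i j + om i j) x i = lap c x i + lap om x i.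
Proof. by rewrite /lap -big_split/=; apply: eq_bigr => j _; ring. Qed.

(** Summation by parts: average the double sum with the one where [i] and [j] are exchanged. *)
Lemma sum_mul_lap c x w : (forall i j, c i j = c j i) ->
  \sum_i w i * lap c x i =
  2^-1 * \sum_i \sum_j c i j * ((x i - x j) * (w i - w j)).
Proof.
move=> sym; apply: (@mulfI _ 2) => //; rewrite mulrA divff// mul1r.
rewrite mulr_natl mulr2n.
have E : \sum_i w i * lap c x i = \sum_i \sum_j w i * (c i j * (x i - x j)).
  by apply: eq_bigr => i _; rewrite mulr_sumr.
rewrite {1}E [X in _ + X]E [X in _ + X]exchange_big -big_split/=.
apply: eq_bigr => i _; rewrite -big_split/=; apply: eq_bigr => j _.
by rewrite (sym j i); ring.
Qed.

Lemma sum_mul_lapC c x w : (forall i j, c i j = c j i) ->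
  \sum_i w i * lap c x i = \sum_i x i * lap c w i.
Proof.
move=> sym; rewrite !sum_mul_lap//; congr (_ * _).
by apply: eq_bigr => i _; apply: eq_bigr => j _; rewrite mulrC (mulrC (x i - _)) mulrC.
Qed.

Lemma le_sum2 (f : 'I_N -> 'I_N -> R) i j :
  (forall i j, 0 <= f i j) -> f i j <= \sum_i \sum_j f i j.
Proof.
move=> f0; rewrite (bigD1 i)//= (bigD1 j)//= -addrA lerDl addr_ge0//.
  exact: sumr_ge0.
by apply: sumr_ge0 => k _; exact: sumr_ge0.
Qed.

Lemma sum2_ge0 (f : 'I_N -> 'I_N -> R) :
  (forall i j, 0 <= f i j) -> 0 <= \sum_i \sum_j f i j.
Proof. by move=> f0; apply: sumr_ge0 => i _; exact: sumr_ge0. Qed.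

End Statics.

(** * The potential and its gradient compared with the distance to the shape *)

Section Energy.
Context {R : realType} {N : nat}.
Context (om kap : 'I_N -> 'I_N -> R) (xe ye : 'I_N -> R) (c0 : R).
Implicit Types (x y w : 'I_N -> R).
Let re := len xe ye.

Hypothesis om_sym : forall i j, om i j = om j i.
Hypothesis om_xe : forall i, lap om xe i = 0.
Hypothesis om_ye : forall i, lap om ye i = 0.
Hypothesis c0_gt0 : 0 < c0.
Hypothesis om_bound : forall x,
  \sum_i lap om x i ^+ 2 <= c0 * \sum_i x i * lap om x i.
Hypothesis kap_gt0 : forall i j, 0 < kap i j.

(** [force x y x] and [force x y y] are the two halves of the gradient of [energy] (not of its
    opposite): abscissas and ordinates share the same weights. *)
Definition force x y (u : 'I_N -> R) : 'I_N -> R :=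
  lap (tension om kap re (len x y)) u.

(* This is [V(q) - V(q^e)]; the sum runs over ordered pairs. *)
Definition energy x y : R :=
  2^-1 * (\sum_i x i * lap om x i + \sum_i y i * lap om y i) +
  4^-1 * \sum_i \sum_j kap i j * (len x y i j - re i j) ^+ 2.

Let K := \sum_i \sum_j kap i j.

Let K_ge0 : 0 <= K. Proof. by apply: sum2_ge0 => i j; exact: ltW. Qed.

Lemma om_form_ge0 x : 0 <= \sum_i x i * lap om x i.
Proof.
rewrite -(pmulr_rge0 _ c0_gt0); apply: le_trans (om_bound x).
by apply: sumr_ge0 => i _; exact: sqr_ge0.
Qed.

Lemma energy_ge0 x y : 0 <= energy x y.
Proof.
rewrite addr_ge0// mulr_ge0 ?invr_ge0//; first by rewrite addr_ge0 ?om_form_ge0.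
by apply: sum2_ge0 => i j; rewrite mulr_ge0 ?sqr_ge0// ltW.
Qed.

(** Young's inequality with weight [c0]; by [om_bound] half of the left-hand side absorbs the
    resulting square. *)
Lemma om_form_le w : \sum_i w i * lap om w i <= c0 * \sum_i w i ^+ 2.
Proof.
have H : 2 * (\sum_i w i * lap om w i) <=
    c0 * \sum_i w i ^+ 2 + c0^-1 * \sum_i lap om w i ^+ 2.
  rewrite !mulr_sumr -big_split/=; apply: ler_sum => i _.
  have E : c0 * w i ^+ 2 + c0^-1 * lap om w i ^+ 2 - 2 * (w i * lap om w i) =
      c0^-1 * (c0 * w i - lap om w i) ^+ 2 by field; rewrite gt_eqF.
  by rewrite -subr_ge0 E mulr_ge0 ?sqr_ge0// invr_ge0 ltW.
have := om_bound w; rewrite -ler_pdivrMl// => H2.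
by move: H H2; set A := \sum_i _; set B := \sum_i _ ^+ 2; set C := c0^-1 * _; lra.
Qed.

(** The factor [u i - u j], at most the length of the edge, cancels the denominator: a term is at
    most [kap * |len - re|], even where the length vanishes. *)
Let force_kap_bound x y (u : 'I_N -> R) : (forall i j, `|u i - u j| <= len x y i j) ->
  forall i, force x y u i ^+ 2 <=
    2 * lap om u i ^+ 2 + 2 * N%:R * K * \sum_j kap i j * (len x y i j - re i j) ^+ 2.
Proof.
move=> ule i; rewrite /force /tension lapDl.
set g := lap (fun i j => kap i j * (1 - re i j / len x y i j)) u i.
have gE : g = \sum_j 1 * (kap i j * (1 - re i j / len x y i j) * (u i - u j)).
  by apply: eq_bigr => j _; rewrite mul1r.
have gb : g ^+ 2 <= N%:R * K * \sum_j kap i j * (len x y i j - re i j) ^+ 2.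
  rewrite gE; apply: (le_trans (sum_cauchy_schwarz _ _)).
  rewrite (_ : \sum_i0 1 ^+ 2 = N%:R); last first.
    by rewrite expr1n sumr_const card_ord.
  rewrite -mulrA ler_wpM2l// mulr_sumr; apply: ler_sum => j _.
  have -> : (kap i j * (1 - re i j / len x y i j) * (u i - u j)) ^+ 2 =
     kap i j * (kap i j * ((1 - re i j / len x y i j) * (u i - u j)) ^+ 2) by ring.
  apply: ler_pM => //.
  - exact: ltW.
  - by rewrite mulr_ge0 ?sqr_ge0// ltW.
  - by apply: (@le_sum2 _ _ kap) => a b; exact: ltW.
  rewrite ler_pM2l// -[leLHS]real_normK ?num_real// -[leRHS]real_normK ?num_real//.
  rewrite ler_pXn2r ?nnegrE// normrM.
  have [r0|] := eqVneq (len x y i j) 0.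
    have := ule i j; rewrite r0 normr_le0 => /eqP ->; by rewrite normr0 mulr0.
  move=> r0; have rgt : 0 < len x y i j by rewrite lt_def r0 norm2_ge0.
  apply: (@le_trans _ _ (`|1 - re i j / len x y i j| * len x y i j)).
    by rewrite ler_wpM2l.
  rewrite -{2}(ger0_norm (ltW rgt)) -normrM mulrBl mul1r divfK//.
apply: (@le_trans _ _ (2 * lap om u i ^+ 2 + 2 * g ^+ 2)).
  by have := sqr_ge0 (lap om u i - g); lra.
by rewrite lerD2l -!mulrA ler_pM2l// !mulrA.
Qed.

(** Lets the cross term [p . grad V] be controlled by [|p|^2] and the energy. In the constant,
    [4 * c0] and [16 * N%:R * K] undo the factors [2^-1] and [4^-1] of [energy]. *)
Lemma force_le_energy : exists C, 0 < C /\
  forall x y, sqnorm (force x y x) (force x y y) <= C * energy x y.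
Proof.
exists (4 * c0 + 16 * N%:R * K); split.
  by rewrite ltr_pwDl ?mulr_gt0// !mulr_ge0.
move=> x y.
set Wx := \sum_i x i * lap om x i.
set Wy := \sum_i y i * lap om y i.
set S := \sum_i \sum_j kap i j * (len x y i j - re i j) ^+ 2.
have S0 : 0 <= S by apply: sum2_ge0 => i j; rewrite mulr_ge0 ?sqr_ge0// ltW.
have H1 : sqnorm (force x y x) (force x y y) <=
    2 * (\sum_i lap om x i ^+ 2 + \sum_i lap om y i ^+ 2) + 4 * N%:R * K * S.
  have -> : 2 * (\sum_i lap om x i ^+ 2 + \sum_i lap om y i ^+ 2) + 4 * N%:R * K * S =
      \sum_i (2 * lap om x i ^+ 2 + 2 * lap om y i ^+ 2 +
        4 * N%:R * K * \sum_j kap i j * (len x y i j - re i j) ^+ 2).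
    by rewrite !big_split/= -!mulr_sumr mulrDr.
  apply: ler_sum => i _.
  have := @force_kap_bound x y x (fun i j => normr_le_norm2l _ _) i.
  have := @force_kap_bound x y y (fun i j => normr_le_norm2r _ _) i.
  by lra.
have H2 := om_bound x; have H3 := om_bound y.
have Wx0 := om_form_ge0 x; have Wy0 := om_form_ge0 y.
have NK : 0 <= N%:R * K by rewrite mulr_ge0.
apply: (le_trans H1); rewrite /energy -/Wx -/Wy -/S.
have P1 : 0 <= N%:R * K * (Wx + Wy) by rewrite mulr_ge0 ?addr_ge0.
have P2 : 0 <= c0 * S by rewrite mulr_ge0// ltW.
move: H2 H3; rewrite -/Wx -/Wy; lra.
Qed.

(** The energy vanishes to second order along the shape: [lap om] kills every rigid image of
    [(xe, ye)], and such an image has edge lengths [re], so [len - re] is at most a difference of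
    two displacements. *)
Lemma energy_le_dist : exists C, 0 < C /\
  forall x y (c s a b : R), c ^+ 2 + s ^+ 2 = 1 ->
  energy x y <= C * sqnorm (fun i => x i - (c * xe i + - s * ye i + a))
                           (fun i => y i - (s * xe i + c * ye i + b)).
Proof.
exists (c0 + K); split; first by rewrite ltr_pwDl.
move=> x y c s a b cs1.
set sx := (fun i => c * xe i + - s * ye i + a).
set sy := (fun i => s * xe i + c * ye i + b).
set wx := fun i => x i - _; set wy := fun i => y i - _.
(* By symmetry of [om], a summand [su] killed by [lap om] drops out of both arguments of the
   form. *)
have shift (u su w : 'I_N -> R) : (forall i, lap om su i = 0) ->
    (forall i, w i = u i - su i) ->
    \sum_i u i * lap om u i = \sum_i w i * lap om w i.
  move=> su0 wE.
  have lapE i : lap om u i = lap om w i.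
    have -> : u = (fun i => w i + su i) by apply/funext => j; rewrite wE subrK.
    by rewrite lapD su0 addr0.
  under eq_bigr do rewrite lapE.
  rewrite sum_mul_lapC//; under eq_bigr do rewrite lapE.
  by [].
have Ex : \sum_i x i * lap om x i = \sum_i wx i * lap om wx i.
  apply: (shift x sx) => // i; by rewrite lap_linear om_xe om_ye !mulr0 addr0.
have Ey : \sum_i y i * lap om y i = \sum_i wy i * lap om wy i.
  apply: (shift y sy) => // i; by rewrite lap_linear om_xe om_ye !mulr0 addr0.
have rE i j : re i j = len sx sy i j.
  rewrite /re /len /norm2; congr Num.sqrt.
  rewrite /sx /sy -[LHS]mul1r -cs1; ring.
set S := sqnorm wx wy.
have S0 : 0 <= S by exact: sqnorm_ge0.
have H i j : kap i j * (len x y i j - re i j) ^+ 2 <= kap i j * (4 * S).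
  rewrite ler_pM2l//; apply: le_trans (sqnorm_diff wx wy i j).
  rewrite rE -sqr_norm2 -real_normK ?num_real//.
  rewrite ler_pXn2r ?nnegrE ?norm2_ge0//.
  apply: (le_trans (norm2_dist _ _ _ _)).
  by rewrite /wx /wy /sx /sy le_eqVlt; apply/orP; left; apply/eqP; congr norm2; ring.
have H' : \sum_i \sum_j kap i j * (len x y i j - re i j) ^+ 2 <= K * (4 * S).
  rewrite /K mulr_suml; apply: ler_sum => i _; rewrite mulr_suml.
  by apply: ler_sum => j _; exact: H.
have SE : S = \sum_i wx i ^+ 2 + \sum_i wy i ^+ 2 by rewrite -big_split.
have Hx := om_form_le wx; have Hy := om_form_le wy.
have c0S : 0 <= c0 * S by rewrite mulr_ge0// ltW.
rewrite /energy Ex Ey; move: Hx Hy H' c0S; rewrite SE.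
lra.
Qed.

End Energy.

Lemma polar_angle (R : realType) (a b : R) :
  exists theta, a = norm2 a b * cos theta /\ b = norm2 a b * sin theta.
Proof.
have [r0|rN0] := eqVneq (norm2 a b) 0.
  by exists 0; rewrite r0 !mul0r; exact: norm2_eq0.
set r := norm2 a b; set c := a / r.
have r_gt0 : 0 < r by rewrite lt_def rN0 norm2_ge0.
have c1 : -1 <= c <= 1.
  rewrite -ler_norml /c normrM normfV (gtr0_norm r_gt0) ler_pdivrMr// mul1r.
  exact: normr_le_norm2l.
have aE : a = r * c by rewrite mulrC divfK.
have sE : Num.sqrt (1 - c ^+ 2) = `|b| / r.
  rewrite -(ger0_norm (_ : 0 <= `|b| / r)) ?divr_ge0 ?norm2_ge0//.
  rewrite -sqrtr_sqr; congr Num.sqrt.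
  rewrite /c !expr_div_n real_normK ?num_real//.
  have e : r ^+ 2 = a ^+ 2 + b ^+ 2 by exact: sqr_norm2.
  have r2 : r ^+ 2 != 0 by rewrite expf_neq0.
  by apply: (mulIf r2); rewrite mulrBl mul1r !divfK// e; ring.
have [b0|b0] := leP 0 b.
  exists (acos c); rewrite acosK ?in_itv//= sin_acos// sE (ger0_norm b0).
  by split=> //; rewrite mulrC divfK.
exists (- acos c); rewrite cosN sinN acosK ?in_itv//= sin_acos// sE (ltr0_norm b0).
by split=> //; rewrite mulNr opprK mulrC divfK.
Qed.

(** * Optimal alignment of a placement with the shape *)

Section NearestPoint.
Context {R : realType} {N : nat} (xe ye : 'I_N -> R).
Hypothesis N_gt0 : (0 < N)%N.
Implicit Types (x y u : 'I_N -> R).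

Definition mean u : R := (\sum_i u i) / N%:R.
Definition centered u i : R := u i - mean u.

Let N0 : N%:R != 0 :> R. Proof. by rewrite pnatr_eq0 -lt0n. Qed.

Lemma sum_centered u : \sum_i centered u i = 0.
Proof.
rewrite big_split/= sumrN sumr_const card_ord -mulr_natr /mean.
by rewrite divfK// subrr.
Qed.

Lemma sum_lin3 (a b c : R) (x y u : 'I_N -> R) :
  \sum_i (a * x i + b * y i + c * u i) =
  a * \sum_i x i + b * \sum_i y i + c * \sum_i u i.
Proof. by rewrite !big_split/= -!mulr_sumr. Qed.

Lemma sum_centered_lin3 (a b c : R) (x y u : 'I_N -> R) :
  \sum_i (a * centered x i + b * centered y i + c * centered u i) = 0.
Proof. by rewrite sum_lin3 !sum_centered; ring. Qed.

(* [dotC x y + i crossC x y] is the complex inner product of the centered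
   placements; its modulus is the maximum over rotations of the real one. *)
Definition dotC x y : R :=
  \sum_i (centered x i * centered xe i + centered y i * centered ye i).
Definition crossC x y : R :=
  \sum_i (centered y i * centered xe i - centered x i * centered ye i).

(** The squared Procrustes distance, with the minimum over translations and rotations already
    carried out. The closed form makes its continuity in the placement immediate. *)
Definition shape_dist2 x y : R :=
  sqnorm (centered x) (centered y) + sqnorm (centered xe) (centered ye)
  - 2 * norm2 (dotC x y) (crossC x y).

Lemma sqnorm_sub_rigid x y (c s a b : R) : c ^+ 2 + s ^+ 2 = 1 ->
  sqnorm (fun i => x i - (c * xe i + - s * ye i + a))
         (fun i => y i - (s * xe i + c * ye i + b)) =
  sqnorm (centered x) (centered y) + sqnorm (centered xe) (centered ye)
  - 2 * (c * dotC x y + s * crossC x y)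
  + N%:R * ((mean x - (c * mean xe - s * mean ye + a)) ^+ 2
          + (mean y - (s * mean xe + c * mean ye + b)) ^+ 2).
Proof.
move=> cs1.
set g := mean x - _; set k := mean y - _.
pose zx i := centered x i - (c * centered xe i - s * centered ye i).
pose zy i := centered y i - (s * centered xe i + c * centered ye i).
have zx0 : \sum_i zx i = 0.
  apply: etrans (sum_centered_lin3 1 (- c) s x xe ye).
  by apply: eq_bigr => i _; rewrite /zx; ring.
have zy0 : \sum_i zy i = 0.
  apply: etrans (sum_centered_lin3 1 (- s) (- c) y xe ye).
  by apply: eq_bigr => i _; rewrite /zy; ring.
transitivity (\sum_i (zx i ^+ 2 + zy i ^+ 2) + 2 * g * \sum_i zx i + 2 * k * \sum_i zy i
    + \sum_(i < N) (g ^+ 2 + k ^+ 2)).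
  rewrite !mulr_sumr -!big_split/=; apply: eq_bigr => i _.
  by rewrite /zx /zy /g /k /centered; ring.
rewrite zx0 zy0 !mulr0 !addr0 sumr_const card_ord -mulr_natl.
congr (_ + _); last by rewrite mulr_natl.
rewrite /sqnorm /dotC /crossC !mulr_sumr -!big_split/= mulr_sumr -sumrN -big_split/=.
apply: eq_bigr => i _.
rewrite (_ : centered xe i ^+ 2 + centered ye i ^+ 2 =
    (c ^+ 2 + s ^+ 2) * (centered xe i ^+ 2 + centered ye i ^+ 2)); last first.
  by rewrite cs1 mul1r.
by rewrite /zx /zy; ring.
Qed.

Lemma shape_dist2_le x y (c s a b : R) : c ^+ 2 + s ^+ 2 = 1 ->
  shape_dist2 x y <= sqnorm (fun i => x i - (c * xe i + - s * ye i + a))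
                            (fun i => y i - (s * xe i + c * ye i + b)).
Proof.
move=> cs1; rewrite sqnorm_sub_rigid// /shape_dist2.
have H1 : c * dotC x y + s * crossC x y <= norm2 (dotC x y) (crossC x y).
  have := dot_le_norm2 c s (dotC x y) (crossC x y).
  by have -> : norm2 c s = 1; [rewrite /norm2 cs1 sqrtr1|rewrite mul1r].
set P := _ ^+ 2 + _ ^+ 2.
have H2 : 0 <= N%:R * P by rewrite mulr_ge0// addr_ge0 ?sqr_ge0.
lra.
Qed.

(* The infinitesimal rigid motions of [(xe, ye)] are spanned by [(1, 0)],
   [(0, 1)] and [(- ye, xe)]. *)
Definition orth_rigid (hx hy : 'I_N -> R) : Prop :=
  [/\ \sum_i hx i = 0, \sum_i hy i = 0 & \sum_i (xe i * hy i - ye i * hx i) = 0].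

(** The angle is the argument of the complex inner product of the centered placements, and the
    translation matches the means. Then [h], the difference turned back to the frame of [(xe, ye)],
    has zero mean, and its moment reduces to [c * crossC - s * dotC], which the choice of the angle
    makes zero. *)
Lemma nearest_shape x y : exists (theta a b : R) (hx hy : 'I_N -> R),
  [/\ forall i, x i = cos theta * (xe i + hx i) + - sin theta * (ye i + hy i) + a,
      forall i, y i = sin theta * (xe i + hx i) + cos theta * (ye i + hy i) + b,
      sqnorm hx hy = shape_dist2 x y,
      orth_rigid hx hy &
      sqnorm (fun i => x i - (cos theta * xe i + - sin theta * ye i + a))
             (fun i => y i - (sin theta * xe i + cos theta * ye i + b)) =
      shape_dist2 x y].
Proof.
have [theta [aE bE]] := polar_angle (dotC x y) (crossC x y).
have cs1 := cos2Dsin2 theta.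
move: cs1 aE bE; set c := cos theta; set s := sin theta => cs1 aE bE.
pose a := mean x - (c * mean xe - s * mean ye).
pose b := mean y - (s * mean xe + c * mean ye).
pose hx i := c * (x i - a) + s * (y i - b) - xe i.
pose hy i := - s * (x i - a) + c * (y i - b) - ye i.
have D : sqnorm (fun i => x i - (c * xe i + - s * ye i + a))
                (fun i => y i - (s * xe i + c * ye i + b)) = shape_dist2 x y.
  rewrite sqnorm_sub_rigid// /shape_dist2.
  have -> : c * dotC x y + s * crossC x y = norm2 (dotC x y) (crossC x y).
    move: aE bE; set r := norm2 _ _ => aE bE.
    by rewrite aE bE -[RHS]mulr1 -cs1; ring.
  by rewrite /a /b; ring.
have hxE i : hx i = c * centered x i + s * centered y i - centered xe i.
  rewrite /hx /a /b /centered.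
  rewrite -[X in _ = _ - (_ - X)]mul1r -cs1.
  by ring.
have hyE i : hy i = - s * centered x i + c * centered y i - centered ye i.
  rewrite /hy /a /b /centered.
  rewrite -[X in _ = _ - (_ - X)]mul1r -cs1.
  by ring.
have hx0 : \sum_i hx i = 0.
  apply: etrans (sum_centered_lin3 c s (- 1) x y xe).
  by apply: eq_bigr => i _; rewrite hxE; ring.
have hy0 : \sum_i hy i = 0.
  apply: etrans (sum_centered_lin3 (- s) c (- 1) x y ye).
  by apply: eq_bigr => i _; rewrite hyE; ring.
exists theta, a, b, hx, hy; split.
- move=> i; rewrite -/c -/s /hx /hy.
  have -> : c * (xe i + (c * (x i - a) + s * (y i - b) - xe i)) +
    - s * (ye i + (- s * (x i - a) + c * (y i - b) - ye i)) + a =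
    (c ^+ 2 + s ^+ 2) * (x i - a) + a by ring.
  by rewrite cs1; ring.
- move=> i; rewrite -/c -/s /hx /hy.
  have -> : s * (xe i + (c * (x i - a) + s * (y i - b) - xe i)) +
    c * (ye i + (- s * (x i - a) + c * (y i - b) - ye i)) + b =
    (c ^+ 2 + s ^+ 2) * (y i - b) + b by ring.
  by rewrite cs1; ring.
- rewrite -D; apply: eq_bigr => i _.
  set wx := x i - _; set wy := y i - _.
  have -> : hx i = c * wx + s * wy.
    rewrite /hx /wx /wy -[X in _ - X = _]mul1r -cs1; ring.
  have -> : hy i = - s * wx + c * wy.
    rewrite /hy /wx /wy -[X in _ - X = _]mul1r -cs1; ring.
  by rewrite -[RHS]mul1r -cs1; ring.
- split=> //.
  transitivity (c * crossC x y - s * dotC x y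
      + mean xe * \sum_i hy i - mean ye * \sum_i hx i).
    rewrite /crossC /dotC !mulr_sumr -!sumrN -!big_split/=.
    apply: eq_bigr => i _; rewrite hxE hyE /centered; ring.
  rewrite hx0 hy0; move: aE bE; set r := norm2 _ _ => aE bE.
  by rewrite aE bE; ring.
- exact: D.
Qed.

End NearestPoint.

(** * Nondegeneracy *)

Section LinearForms.
Context {R : realFieldType} {J : finType}.
Implicit Types f g : (J -> R) -> R.

(** The coefficients are only asserted to exist, so that forms given by natural formulas can be fed
    to [linear_forms_bound] without writing out their matrix. *)
Definition linear_form f := exists A, forall h, f h = \sum_j A j * h j.

Lemma linear_form_coord j : linear_form (fun h => h j).
Proof.
exists (fun i => (i == j)%:R) => h.
by rewrite (bigD1 j)//= eqxx mul1r big1 ?addr0// => i /negPf ->; rewrite mul0r.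
Qed.

Lemma linear_formD f g : linear_form f -> linear_form g ->
  linear_form (fun h => f h + g h).
Proof.
move=> [A fE] [B gE]; exists (fun j => A j + B j) => h.
by rewrite fE gE -big_split; apply: eq_bigr => j _; rewrite mulrDl.
Qed.

Lemma linear_formZ c f : linear_form f -> linear_form (fun h => c * f h).
Proof.
move=> [A fE]; exists (fun j => c * A j) => h.
by rewrite fE mulr_sumr; apply: eq_bigr => j _; rewrite mulrA.
Qed.

Lemma linear_formB f g : linear_form f -> linear_form g ->
  linear_form (fun h => f h - g h).
Proof.
move=> lf lg; have [A AE] := linear_formD lf (linear_formZ (-1) lg).
by exists A => h; rewrite -AE mulN1r.
Qed.

Lemma linear_form_sum (I : finType) (f : I -> (J -> R) -> R) :
  (forall i, linear_form (f i)) -> linear_form (fun h => \sum_i f i h).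
Proof.
move=> /choice[A fE]; exists (fun j => \sum_i A i j) => h.
under eq_bigr do rewrite fE.
by rewrite exchange_big; apply: eq_bigr => j _; rewrite mulr_suml.
Qed.

End LinearForms.

(* With [a = e . d] and [m = |d|^2], the right-hand side is
   [(2 a + m) (a + m) / (r (r + rho))] for [rho = |e|] and [r = |e + d|],
   and [(2 a + m) (a + m) = a^2 - 5/4 m^2 + (a + 3/2 m)^2]. *)
Lemma edge_monotone (R : realType) (ex ey dx dy : R) :
  0 < norm2 ex ey -> 4 * (dx ^+ 2 + dy ^+ 2) <= norm2 ex ey ^+ 2 ->
  4 / 15 * ((ex * dx + ey * dy) ^+ 2 / norm2 ex ey ^+ 2)
    - 5 / 3 * ((dx ^+ 2 + dy ^+ 2) ^+ 2 / norm2 ex ey ^+ 2) <=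
  (1 - norm2 ex ey / norm2 (ex + dx) (ey + dy)) *
    ((ex + dx) * dx + (ey + dy) * dy).
Proof.
set rho := norm2 ex ey; set r := norm2 (ex + dx) (ey + dy).
set m := dx ^+ 2 + dy ^+ 2; set a := ex * dx + ey * dy => rho0 dle.
have dn : norm2 dx dy <= rho / 2.
  by apply: norm2_le; [rewrite divr_ge0// ltW|rewrite expr_div_n -/m; lra].
have /ler_normlP[r1 r2] : `|r - rho| <= rho / 2.
  apply: le_trans dn; apply: (le_trans (norm2_dist _ _ _ _)).
  by rewrite addrAC subrr add0r addrAC subrr add0r.
have r0 : 0 < r by lra.
have rE : r ^+ 2 = rho ^+ 2 + 2 * a + m by rewrite !sqr_norm2 /a /m; ring.
have -> : (ex + dx) * dx + (ey + dy) * dy = a + m by rewrite /a /m; ring.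
clearbody r rho m a.
pose P := r * (r + rho).
have P0 : 0 < P by rewrite mulr_gt0// addr_gt0.
have -> : (1 - rho / r) * (a + m) = (2 * a + m) * (a + m) / P.
  have -> : 2 * a + m = (r - rho) * (r + rho) by rewrite -subr_sqr rE; ring.
  rewrite /P; field.
  by rewrite !gt_eqF// addr_gt0.
have P1 : P <= 15 / 4 * rho ^+ 2.
  rewrite /P (_ : 15 / 4 * rho ^+ 2 = (3 / 2 * rho) * (5 / 2 * rho)); last by field.
  by apply: ler_pM; lra.
have P2 : 3 / 4 * rho ^+ 2 <= P.
  rewrite /P (_ : 3 / 4 * rho ^+ 2 = (1 / 2 * rho) * (3 / 2 * rho)); last by field.
  by apply: ler_pM; lra.
have rho2 : 0 < rho ^+ 2 by rewrite exprn_gt0.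
have Q1 : 4 / 15 * (a ^+ 2 / rho ^+ 2) <= a ^+ 2 / P.
  rewrite ler_pdivlMr// (_ : _ * P = a ^+ 2 * (4 / 15 * (P / rho ^+ 2))); last by ring.
  rewrite ler_piMr ?sqr_ge0//.
  by have := P1; rewrite -ler_pdivrMr//; lra.
have Q2 : m ^+ 2 / P <= 4 / 3 * (m ^+ 2 / rho ^+ 2).
  rewrite ler_pdivrMr// (_ : _ * P = m ^+ 2 * (4 / 3 * (P / rho ^+ 2))); last by ring.
  rewrite ler_peMr ?sqr_ge0//.
  by have := P2; rewrite -ler_pdivlMr//; lra.
have Q3 : (a ^+ 2 - 5 / 4 * m ^+ 2) / P <= (2 * a + m) * (a + m) / P.
  rewrite ler_pM2r ?invr_gt0// -subr_ge0.
  by rewrite (_ : _ - _ = (a + 3 / 2 * m) ^+ 2) ?sqr_ge0//; field.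
apply: le_trans Q3; rewrite mulrBl -(mulrA (5 / 4)); lra.
Qed.

Lemma eq0_of_det (R : fieldType) (p q x1 y1 x2 y2 : R) :
  x1 * y2 - x2 * y1 != 0 -> p * x1 + q * y1 = 0 -> p * x2 + q * y2 = 0 ->
  p = 0 /\ q = 0.
Proof.
move=> det e1 e2; split; apply: (mulIf det); rewrite mul0r.
  transitivity (y2 * (p * x1 + q * y1) - y1 * (p * x2 + q * y2)); first by ring.
  by rewrite e1 e2; ring.
transitivity (x1 * (p * x2 + q * y2) - x2 * (p * x1 + q * y1)); first by ring.
by rewrite e1 e2; ring.
Qed.

(** By polarization the symmetric bilinear form vanishes on a basis. The three vectors will be the
    sides of a nondegenerate triangle of nodes. *)
Lemma quadratic_form_eq0 (R : numFieldType) (A B C x1 y1 x2 y2 : R) :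
  let q x y := A * x ^+ 2 + B * (x * y) + C * y ^+ 2 in
  x1 * y2 - x2 * y1 != 0 ->
  q x1 y1 = 0 -> q x2 y2 = 0 -> q (x1 - x2) (y1 - y2) = 0 ->
  [/\ A = 0, B = 0 & C = 0].
Proof.
move=> q det q1 q2 q12.
have b12 : 2 * A * (x1 * x2) + B * (x1 * y2 + x2 * y1) + 2 * C * (y1 * y2) = 0.
  transitivity (q x1 y1 + q x2 y2 - q (x1 - x2) (y1 - y2)); first by rewrite /q; ring.
  by rewrite q1 q2 q12; ring.
have [P1 Q1] : 2 * A * x1 + B * y1 = 0 /\ B * x1 + 2 * C * y1 = 0.
  apply: (eq0_of_det det).
    by transitivity (2 * q x1 y1); [rewrite /q; ring|rewrite q1 mulr0].
  by rewrite -[RHS]b12; ring.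
have [P2 Q2] : 2 * A * x2 + B * y2 = 0 /\ B * x2 + 2 * C * y2 = 0.
  apply: (eq0_of_det det).
    by rewrite -[RHS]b12; ring.
  by transitivity (2 * q x2 y2); [rewrite /q; ring|rewrite q2 mulr0].
have [/eqP A0 B0] := eq0_of_det det P1 P2.
have [_ /eqP C0] := eq0_of_det det Q1 Q2.
move: A0 C0; rewrite !mulf_eq0 !pnatr_eq0/= => /eqP A0 /eqP C0.
by split.
Qed.

(** * From infinitesimal rigidity to the gradient inequality near the shape *)

Section Rigidity.
Context {R : realType} {N : nat}.
Context (om kap : 'I_N -> 'I_N -> R) (xe ye : 'I_N -> R) (c0 : R).
Implicit Types (x y w hx hy : 'I_N -> R).
Let re := len xe ye.

Hypothesis om_sym : forall i j, om i j = om j i.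
Hypothesis om_xe : forall i, lap om xe i = 0.
Hypothesis om_ye : forall i, lap om ye i = 0.
Hypothesis c0_gt0 : 0 < c0.
Hypothesis om_bound : forall x,
  \sum_i lap om x i ^+ 2 <= c0 * \sum_i x i * lap om x i.
Hypothesis om_ker : forall x, (forall i, lap om x i = 0) ->
  exists a b c : R, forall i, x i = a * xe i + b * ye i + c.
Hypothesis kap_sym : forall i j, kap i j = kap j i.
Hypothesis kap_gt0 : forall i j, 0 < kap i j.
Hypothesis re_gt0 : forall i j, i != j -> 0 < re i j.
Hypothesis noncollinear : exists i j k,
  (xe j - xe i) * (ye k - ye i) - (xe k - xe i) * (ye j - ye i) != 0.

(** The first variation of half the squared length of the edge [i j] of [(xe, ye)] in the direction
    [h]. *)
Definition stretch hx hy i j : R :=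
  (xe i - xe j) * (hx i - hx j) + (ye i - ye j) * (hy i - hy j).

(** For affine [h] the stretch of an edge is the quadratic form of the linear part; when it vanishes
    on a triangle, the linear part is antisymmetric. *)
Lemma infinitesimal_rigidity hx hy : (forall i, lap om hx i = 0) ->
  (forall i, lap om hy i = 0) -> (forall i j, stretch hx hy i j = 0) ->
  orth_rigid xe ye hx hy -> forall i, hx i = 0 /\ hy i = 0.
Proof.
move=> /om_ker[a [b [c hxE]]] /om_ker[a' [b' [c' hyE]]] st0 [sx sy sr].
have q0 i j : a * (xe i - xe j) ^+ 2 + (b + a') * ((xe i - xe j) * (ye i - ye j))
    + b' * (ye i - ye j) ^+ 2 = 0.
  by rewrite -[RHS](st0 i j) /stretch !hxE !hyE; ring.
have [i0 [j0 [k0 det]]] := noncollinear.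
have [a0 ba b0] : [/\ a = 0, b + a' = 0 & b' = 0].
  apply: (quadratic_form_eq0 det); [exact: q0|exact: q0|].
  by apply: etrans (q0 j0 k0) => /=; ring.
(* Now [h = a' (- ye, xe) + (c, c')], so [|h|^2] is a combination of the three sums that
   [orth_rigid] sets to zero. *)
have s0 : sqnorm hx hy = 0.
  transitivity (a' * (\sum_i (xe i * hy i - ye i * hx i)) + c * \sum_i hx i + c' * \sum_i hy i).
    rewrite !mulr_sumr -!big_split/=; apply: eq_bigr => i _.
    have -> : hx i ^+ 2 + hy i ^+ 2 =
      hx i * (a * xe i + b * ye i + c) + hy i * (a' * xe i + b' * ye i + c').
      by rewrite -hxE -hyE !expr2.
    have -> : b = - a' by apply/eqP; rewrite -addr_eq0 ba.
    by rewrite a0 b0; ring.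
  by rewrite sx sy sr; ring.
move=> i; have := le_sqnorm hx hy i; rewrite s0 => le0.
have := sqr_ge0 (hx i); have := sqr_ge0 (hy i) => h1 h2.
by split; apply/eqP; rewrite -sqrf_eq0 eq_le; apply/andP; split=> //; lra.
Qed.

(** The orthogonality conditions are included among the forms to obtain injectivity; on the [h]
    considered they contribute nothing to the bound. *)
Lemma linearized_bound : exists C : R, 0 < C /\ forall hx hy,
  orth_rigid xe ye hx hy ->
  sqnorm hx hy <= C * (\sum_i lap om hx i ^+ 2 + \sum_i lap om hy i ^+ 2
    + \sum_i \sum_j stretch hx hy i j ^+ 2).
Proof.
pose J := ('I_N + 'I_N)%type.
pose K := ((('I_N + 'I_N) + ('I_N * 'I_N)) + (bool + unit))%type.
pose F (k : K) (h : J -> R) : R :=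
  let hx i := h (inl i) in let hy i := h (inr i) in
  match k with
  | inl (inl (inl i)) => lap om hx i
  | inl (inl (inr i)) => lap om hy i
  | inl (inr p) => stretch hx hy p.1 p.2
  | inr (inl true) => \sum_i hx i
  | inr (inl false) => \sum_i hy i
  | inr (inr _) => \sum_i (xe i * hy i - ye i * hx i)
  end.
have lap_form (s : 'I_N -> J) i : linear_form (fun h => lap om (fun j => h (s j)) i).
  apply: linear_form_sum => j; apply: linear_formZ.
  by apply: linear_formB; exact: linear_form_coord.
have /choice[A AE] : forall k, linear_form (F k).
  case=> [[[i|i]|[i j]]|[[|]|u]] /=.
  - exact: lap_form.
  - exact: lap_form.
  - by apply: linear_formD; apply: linear_formZ; apply: linear_formB;
      exact: linear_form_coord.
  - by apply: linear_form_sum => i; exact: linear_form_coord.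
  - by apply: linear_form_sum => i; exact: linear_form_coord.
  - apply: linear_form_sum => i.
    by apply: linear_formB; apply: linear_formZ; exact: linear_form_coord.
have [|C [C0 HC]] := @linear_forms_bound R J K A.
  move=> h h0.
  have F0 k : F k h = 0 by rewrite AE.
  have := @infinitesimal_rigidity (fun i => h (inl i)) (fun i => h (inr i)).
  move=> /(_ (fun i => F0 (inl (inl (inl i)))) (fun i => F0 (inl (inl (inr i))))
    (fun i j => F0 (inl (inr (i, j))))) H.
  have {}H := H (And3 (F0 (inr (inl true))) (F0 (inr (inl false))) (F0 (inr (inr tt)))).
  by case=> i; have [] := H i.
exists C; split=> // hx hy [sx sy sr].
pose h (j : J) := match j with inl i => hx i | inr i => hy i end.
have := HC h; rewrite big_sumType/=.
under [X in _ <= C * X]eq_bigr do rewrite -AE.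
rewrite [\sum_(k : K) _]big_sumType/= [\sum_(k : _ + _ * _) _]big_sumType/=.
rewrite [\sum_(k : 'I_N + 'I_N) _]big_sumType/= -big_split/=.
rewrite [X in _ + X]big1 ?addr0; last first.
  by case=> [[|]|u] _; rewrite /= ?sx ?sy ?sr expr0n.
rewrite [X in C * (_ + X)](_ : _ = \sum_i \sum_j stretch hx hy i j ^+ 2) //.
by rewrite pair_bigA.
Qed.

Lemma re_lower_bound : exists rho, 0 < rho /\ forall i j, i != j -> rho <= re i j.
Proof.
(* Diagonal terms are [0^-1 = 0]; the [1] makes [T] positive whatever [N]. *)
pose T := 1 + \sum_i \sum_j (re i j)^-1.
have T0 : 0 < T by rewrite ltr_pwDl// sum2_ge0// => i j; rewrite invr_ge0 norm2_ge0.
exists T^-1; split=> [|i j ij]; first by rewrite invr_gt0.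
rewrite -[leRHS]invrK lef_pV2 ?posrE ?invr_gt0 ?re_gt0//.
apply: (@le_trans _ _ (\sum_i \sum_j (re i j)^-1)); last by rewrite lerDr.
by apply: (@le_sum2 _ _ (fun i j => (re i j)^-1)) => a b; rewrite invr_ge0 norm2_ge0.
Qed.

(** Edge by edge, [edge_monotone] gives a term quadratic in the stretch minus a quartic error. The
    quadratic terms and the stress form are coercive by [linearized_bound], and a small [eta]
    absorbs the error. *)
Lemma force_form_ge : exists eta c, [/\ 0 < eta, 0 < c & forall hx hy,
  let X i := xe i + hx i in let Y i := ye i + hy i in
  orth_rigid xe ye hx hy -> sqnorm hx hy <= eta ->
  c * sqnorm hx hy <= \sum_i (hx i * force om kap xe ye X Y X i +
                              hy i * force om kap xe ye X Y Y i)].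
Proof.
have [C [C0 HC]] := linearized_bound.
have [rho [rho0 rho_le]] := re_lower_bound.
pose K2 := \sum_i \sum_j re i j ^+ 2 / kap i j.
have K20 : 0 <= K2.
  by apply: sum2_ge0 => i j; rewrite divr_ge0 ?sqr_ge0// ltW.
(* [5 / 3] from [edge_monotone], times [16] from [(dx^2 + dy^2)^2 <= (4 S)^2], times [1 / 2] because
   ordered pairs are summed. *)
pose B := 40 / 3 * \sum_i \sum_j kap i j / re i j ^+ 2.
have B0 : 0 <= B.
  by rewrite mulr_ge0// sum2_ge0// => i j; rewrite divr_ge0 ?sqr_ge0// ltW.
pose c1 := (C * (c0 + K2))^-1.
have c10 : 0 < c1 by rewrite invr_gt0 mulr_gt0// ltr_pwDl.
(* The first bound meets the smallness condition of [edge_monotone]; the second gives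
   [B * S <= c1 / 15]. *)
pose eta := Num.min (rho ^+ 2 / 16) (c1 / (15 * (B + 1))).
have B1 : 0 < 15 * (B + 1) by rewrite mulr_gt0// ltr_wpDl.
exists eta, (c1 / 15); split.
- by rewrite lt_min !divr_gt0// exprn_gt0.
- by rewrite divr_gt0.
move=> hx hy X Y orth hle.
set S := sqnorm hx hy in hle *.
have S0 : 0 <= S by exact: sqnorm_ge0.
have [Srho SB] : 16 * S <= rho ^+ 2 /\ B * S <= c1 / 15.
  move: hle; rewrite le_min => /andP[h1 h2]; split; first lra.
  move: h2; rewrite ler_pdivlMr// => h2.
  have : 0 <= 15 * S by rewrite mulr_ge0.
  lra.
pose A := \sum_i hx i * lap om hx i + \sum_i hy i * lap om hy i.
have A0 : 0 <= A by rewrite addr_ge0// (om_form_ge0 c0_gt0 om_bound).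
pose E := \sum_i \sum_j kap i j * (stretch hx hy i j ^+ 2 / re i j ^+ 2).
have E0 : 0 <= E.
  by apply: sum2_ge0 => i j; rewrite mulr_ge0 ?divr_ge0 ?sqr_ge0// ltW.
have Sle : c1 * S <= A + E.
  rewrite ler_pdivrMl ?mulr_gt0 ?ltr_pwDl//.
  apply: (le_trans (HC _ _ orth)); rewrite -mulrA ler_pM2l//.
  have H1 := om_bound hx; have H2 := om_bound hy.
  have H3 : \sum_i \sum_j stretch hx hy i j ^+ 2 <= K2 * E.
    rewrite mulr_sumr; apply: ler_sum => i _.
    rewrite mulr_sumr; apply: ler_sum => j _.
    have [<-|ij] := eqVneq i j.
      by rewrite /stretch !subrr !mul0r addr0 expr0n/= mul0r !mulr0.
    have re0 := re_gt0 ij.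
    rewrite [leLHS](_ : _ =
        re i j ^+ 2 / kap i j * (kap i j * (stretch hx hy i j ^+ 2 / re i j ^+ 2))).
      2: by field; rewrite !gt_eqF.
    apply: ler_wpM2r; first by rewrite mulr_ge0 ?divr_ge0 ?sqr_ge0// ltW.
    apply: (@le_sum2 _ _ (fun i j => re i j ^+ 2 / kap i j)) => a b.
    by rewrite divr_ge0 ?sqr_ge0// ltW.
  have P1 : 0 <= K2 * A by rewrite mulr_ge0.
  have P2 : 0 <= c0 * E by rewrite mulr_ge0// ltW.
  by move: H1 H2 P1; rewrite /A; lra.
pose g i j := kap i j * (1 - re i j / len X Y i j).
have g_sym i j : g i j = g j i by rewrite /g kap_sym len_sym /re len_sym.
have forceE (u h : 'I_N -> R) ue : (forall i, lap om ue i = 0) ->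
    u = (fun i => ue i + h i) ->
    \sum_i h i * force om kap xe ye X Y u i = \sum_i h i * lap om h i +
      2^-1 * \sum_i \sum_j g i j * ((u i - u j) * (h i - h j)).
  move=> ue0 uE; rewrite -sum_mul_lap// -big_split/=.
  apply: eq_bigr => i _; rewrite -mulrDr; congr (_ * _).
  by rewrite /force /tension lapDl {1}uE lapD ue0 add0r.
rewrite big_split/= (forceE X hx xe)// (forceE Y hy ye)//.
rewrite addrACA -/A -mulrDr -big_split/=.
have edge i j : 4 / 15 * (kap i j * (stretch hx hy i j ^+ 2 / re i j ^+ 2))
    - 80 / 3 * S ^+ 2 * (kap i j / re i j ^+ 2) <=
    g i j * ((X i - X j) * (hx i - hx j)) + g i j * ((Y i - Y j) * (hy i - hy j)).
  have [<-|ij] := eqVneq i j.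
    rewrite /re len_diag expr0n/= invr0 !subrr !mulr0 subrr.
    by rewrite addr0.
  have re0 := re_gt0 ij.
  pose dx := hx i - hx j; pose dy := hy i - hy j.
  have dS : dx ^+ 2 + dy ^+ 2 <= 4 * S by exact: sqnorm_diff.
  have drho : 4 * (dx ^+ 2 + dy ^+ 2) <= re i j ^+ 2.
    apply: (@le_trans _ _ (rho ^+ 2)).
      by apply: le_trans Srho; rewrite -[16]/((4 * 4)%:R) natrM -mulrA ler_pM2l.
    by rewrite ler_pXn2r ?nnegrE ?rho_le// ltW.
  have := edge_monotone re0 drho.
  have -> : norm2 (xe i - xe j + dx) (ye i - ye j + dy) = len X Y i j.
    by rewrite /len /X /Y /dx /dy; congr norm2; ring.
  rewrite -/(re i j) -[norm2 _ _]/(re i j) => /(ler_wpM2l (ltW (kap_gt0 i j))) H.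
  have m2 : (dx ^+ 2 + dy ^+ 2) ^+ 2 <= 16 * S ^+ 2.
    rewrite (_ : 16 * S ^+ 2 = (4 * S) ^+ 2); last by ring.
    by rewrite ler_pXn2r ?nnegrE ?addr_ge0 ?sqr_ge0// mulr_ge0.
  have kr0 : 0 <= kap i j / re i j ^+ 2 by rewrite divr_ge0 ?sqr_ge0// ltW.
  have mk := ler_wpM2r kr0 m2.
  have -> : g i j * ((X i - X j) * (hx i - hx j)) + g i j * ((Y i - Y j) * (hy i - hy j)) =
      kap i j * ((1 - re i j / len X Y i j) *
        ((xe i - xe j + dx) * dx + (ye i - ye j + dy) * dy)).
    by rewrite /g /X /Y /dx /dy; ring.
  apply: le_trans H; rewrite mulrBr; apply: lerB; first by rewrite mulrCA.
  have -> : kap i j * (5 / 3 * ((dx ^+ 2 + dy ^+ 2) ^+ 2 / re i j ^+ 2)) =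
    5 / 3 * ((dx ^+ 2 + dy ^+ 2) ^+ 2 * (kap i j / re i j ^+ 2)) by ring.
  have -> : 80 / 3 * S ^+ 2 * (kap i j / re i j ^+ 2) =
    5 / 3 * (16 * S ^+ 2 * (kap i j / re i j ^+ 2)) by field; rewrite gt_eqF.
  by rewrite ler_pM2l.
have sumE : 4 / 15 * E - 2 * (B * S) * S <=
   \sum_i (\sum_j g i j * ((X i - X j) * (hx i - hx j)) +
      \sum_j g i j * ((Y i - Y j) * (hy i - hy j))).
  have -> : 4 / 15 * E - 2 * (B * S) * S =
     \sum_i \sum_j (4 / 15 * (kap i j * (stretch hx hy i j ^+ 2 / re i j ^+ 2))
    - 80 / 3 * S ^+ 2 * (kap i j / re i j ^+ 2)).
    under [RHS]eq_bigr do rewrite big_split/= sumrN -!mulr_sumr.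
    rewrite big_split/= sumrN -!mulr_sumr -/E /B; by field.
  by apply: ler_sum => i _; rewrite -big_split; apply: ler_sum => j _; exact: edge.
(* In total [A + 2/15 E - B S^2 >= 2/15 (A + E) - c1/15 S >= c1/15 S]. *)
have SBS : B * S * S <= c1 / 15 * S by rewrite ler_wpM2r.
lra.
Qed.

Lemma len_rigid (c s a b : R) x y X Y : c ^+ 2 + s ^+ 2 = 1 ->
  (forall i, x i = c * X i + - s * Y i + a) ->
  (forall i, y i = s * X i + c * Y i + b) -> forall i j, len x y i j = len X Y i j.
Proof.
move=> cs1 xE yE i j; rewrite /len /norm2 !xE !yE; congr Num.sqrt.
by rewrite -[RHS]mul1r -cs1; ring.
Qed.

(** The weights depend on lengths only and the Laplacian commutes with affine maps, so the gradient
    turns with the placement. *)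
Lemma sqnorm_force_rigid (c s a b : R) x y X Y : c ^+ 2 + s ^+ 2 = 1 ->
  (forall i, x i = c * X i + - s * Y i + a) ->
  (forall i, y i = s * X i + c * Y i + b) ->
  sqnorm (force om kap xe ye x y x) (force om kap xe ye x y y) =
  sqnorm (force om kap xe ye X Y X) (force om kap xe ye X Y Y).
Proof.
move=> cs1 xE yE.
have lenE : len x y = len X Y.
  by apply/funext => i; apply/funext => j; exact: (len_rigid cs1 xE yE).
apply: eq_bigr => i _; rewrite /force lenE; set t := tension _ _ _ _.
have -> : x = (fun i => c * X i + - s * Y i + a) by apply/funext.
have -> : y = (fun i => s * X i + c * Y i + b) by apply/funext.
by rewrite !lap_linear -[RHS]mul1r -cs1; ring.
Qed.

Hypothesis N_gt0 : (0 < N)%N.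

(** After alignment, Young's inequality [h . F <= c/2 |h|^2 + |F|^2 / (2 c)] turns [force_form_ge]
    into [|h|^2 <= |F|^2 / c^2]. The constants are uniform along the whole shape. *)
Lemma near_shape : exists eta C rho, [/\ 0 < eta, 0 < C, 0 < rho &
  forall x y, shape_dist2 xe ye x y <= eta ->
  shape_dist2 xe ye x y <=
    C * sqnorm (force om kap xe ye x y x) (force om kap xe ye x y y) /\
  forall i j, i != j -> rho <= len x y i j].
Proof.
have [eta [c [eta0 c0' H]]] := force_form_ge.
have [rho [rho0 rho_le]] := re_lower_bound.
(* With [|h|^2 <= rho^2 / 16] an edge vector moves by at most [2 |h| <= rho / 2]. *)
exists (Num.min eta (rho ^+ 2 / 16)), (c ^- 2), (rho / 2); split.
- by rewrite lt_min eta0 divr_gt0// exprn_gt0.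
- by rewrite invr_gt0 exprn_gt0.
- by rewrite divr_gt0.
move=> x y; have [theta [a [b [hx [hy [xE yE <- orth _]]]]]] := nearest_shape xe ye N_gt0 x y.
rewrite le_min => /andP[h1 h2].
have cs1 := cos2Dsin2 theta.
pose X i := xe i + hx i; pose Y i := ye i + hy i.
split.
  rewrite (sqnorm_force_rigid (X := X) (Y := Y) cs1 xE yE).
  have {}H := H hx hy orth h1.
  set F := sqnorm (force _ _ _ _ _ _ _) _.
  have G : \sum_i (hx i * force om kap xe ye X Y X i + hy i * force om kap xe ye X Y Y i)
     <= c / 2 * sqnorm hx hy + (2 * c)^-1 * F.
    rewrite !mulr_sumr -big_split/=; apply: ler_sum => i _.
    set fx := force _ _ _ _ _ _ X i; set fy := force _ _ _ _ _ _ Y i.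
    rewrite -subr_ge0 (_ : _ - _ = (2 * c)^-1 * ((c * hx i - fx) ^+ 2 + (c * hy i - fy) ^+ 2)).
      by rewrite mulr_ge0 ?addr_ge0 ?sqr_ge0// invr_ge0 mulr_ge0// ltW.
    by field; rewrite gt_eqF.
  have := le_trans H G.
  have -> : (2 * c)^-1 * F = c / 2 * (c ^- 2 * F) by field; rewrite gt_eqF.
  set S := sqnorm _ _; set T := c ^- 2 * F => ST.
  rewrite -(@ler_pM2l _ (c / 2)) ?divr_gt0//; lra.
move=> i j ij; rewrite (len_rigid (X := X) (Y := Y) cs1 xE yE).
have re_rho := rho_le _ _ ij.
have d2 : norm2 (hx i - hx j) (hy i - hy j) <= rho / 2.
  apply: norm2_le; first by rewrite divr_ge0// ltW.
  by apply: (le_trans (sqnorm_diff _ _ _ _)); rewrite expr_div_n; lra.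
have : re i j - len X Y i j <= norm2 (hx i - hx j) (hy i - hy j).
  apply: (le_trans (ler_norm _)); rewrite distrC.
  apply: (le_trans (norm2_dist _ _ _ _)); rewrite le_eqVlt; apply/orP; left.
  by apply/eqP; congr norm2; rewrite /X /Y; ring.
lra.
Qed.

End Rigidity.

(** * The Lyapunov function *)

Section NormDerivative.
Context {R : realType}.

Lemma is_derive_norm2 (f g : R -> R) (t df dg : R) : is_derive t 1 f df -> is_derive t 1 g dg ->
  0 < norm2 (f t) (g t) ->
  is_derive t 1 (fun s => norm2 (f s) (g s))
    ((f t * df + g t * dg) / norm2 (f t) (g t)).
Proof.
move=> Df Dg n0.
have D := is_derive_add (is_derive_sqr Df) (is_derive_sqr Dg).
have n0' : 0 < f t ^+ 2 + g t ^+ 2 by rewrite -norm2_gt0.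
have C := @is_derive1_comp _ Num.sqrt (fun s => f s ^+ 2 + g s ^+ 2) t _ _
  (is_derive1_sqrt n0') D.
apply: (is_derive_eqfun C) => //.
by rewrite -/(norm2 _ _); field; rewrite gt_eqF.
Qed.

End NormDerivative.

(** * Derivatives of the energy and of the cross term along a trajectory *)

Section AlongCurve.
Context {R : realType} {N : nat}.
Context (om kap : 'I_N -> 'I_N -> R) (xe ye : 'I_N -> R).
Let re := len xe ye.
Hypothesis om_sym : forall i j, om i j = om j i.
Hypothesis kap_sym : forall i j, kap i j = kap j i.
Hypothesis kap_gt0 : forall i j, 0 < kap i j.

Context (x y px py : R -> 'I_N -> R) (ax ay : 'I_N -> R) (t : R).
Hypothesis Dx : forall i, is_derive t 1 (x^~ i) (px t i).
Hypothesis Dy : forall i, is_derive t 1 (y^~ i) (py t i).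
Hypothesis Dpx : forall i, is_derive t 1 (px^~ i) (ax i).
Hypothesis Dpy : forall i, is_derive t 1 (py^~ i) (ay i).
Hypothesis len_gt0 : forall i j, i != j -> 0 < len (x t) (y t) i j.

Let F := force om kap xe ye.

(** This is [p . grad V]: both the time derivative of the potential and the cross term of the
    Lyapunov function. *)
Definition power (s : R) : R :=
  \sum_i (px s i * F (x s) (y s) (x s) i + py s i * F (x s) (y s) (y s) i).

Let tension_sym (u w : 'I_N -> R) i j :
  tension om kap re (len u w) i j = tension om kap re (len u w) j i.
Proof. by rewrite /tension om_sym kap_sym /re !(len_sym _ _ i). Qed.

Let g_sym (u w : 'I_N -> R) i j :
  kap i j * (1 - re i j / len u w i j) = kap j i * (1 - re j i / len u w j i).
Proof. by rewrite kap_sym /re !(len_sym _ _ i). Qed.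

Let Dlen i j : i != j -> is_derive t 1 (fun s => len (x s) (y s) i j)
  (((x t i - x t j) * (px t i - px t j) + (y t i - y t j) * (py t i - py t j))
    / len (x t) (y t) i j).
Proof.
by move=> ij; apply: is_derive_norm2; exact: len_gt0.
Qed.

Let Dform (u du : R -> 'I_N -> R) : (forall i, is_derive t 1 (u^~ i) (du t i)) ->
  is_derive t 1 (fun s => \sum_i u s i * lap om (u s) i)
    (2 * \sum_i du t i * lap om (u t) i).
Proof.
move=> Du.
have Dlap i : is_derive t 1 (fun s => lap om (u s) i) (lap om (du t) i).
  by apply: is_derive_bigsum => j _; apply: is_derive_scale; exact: is_derive_sub.
have D : is_derive t 1 (fun s => \sum_i u s i * lap om (u s) i)
    (\sum_i (du t i * lap om (u t) i + u t i * lap om (du t) i)).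
  by apply: is_derive_bigsum => i _; exact: is_derive_mul.
apply: (is_derive_eqfun D) => //.
by rewrite big_split/= [X in _ + X]sum_mul_lapC//; ring.
Qed.

Lemma is_derive_energy :
  is_derive t 1 (fun s => energy om kap xe ye (x s) (y s)) (power t).
Proof.
have Dedge i j : is_derive t 1
    (fun s => kap i j * (len (x s) (y s) i j - re i j) ^+ 2)
    (2 * (kap i j * (1 - re i j / len (x t) (y t) i j) *
      ((x t i - x t j) * (px t i - px t j) + (y t i - y t j) * (py t i - py t j)))).
  have [<-|ij] := eqVneq i j.
    apply: (is_derive_eqfun (is_derive_const (kap i i * (0 - re i i) ^+ 2) t)).
      by move=> s; rewrite len_diag.
    by rewrite !subrr !mul0r addr0 !mulr0.
  apply: (is_derive_eqfun (is_derive_scale (kap i j)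
    (is_derive_sqr (is_derive_sub (Dlen ij) (is_derive_const (re i j) t))))) => //.
  have rN : len (x t) (y t) i j != 0 by rewrite gt_eqF// len_gt0.
  by cbv beta; rewrite subr0; field.
have D : is_derive t 1 (fun s => energy om kap xe ye (x s) (y s)) _ :=
  is_derive_add (is_derive_scale 2^-1 (is_derive_add (Dform Dx) (Dform Dy)))
   (is_derive_scale 4^-1 (is_derive_bigsum (fun i _ =>
      is_derive_bigsum (fun j _ => Dedge i j)))).
apply: (is_derive_eqfun D) => //.
rewrite /power big_split/=.
have FE u : F (x t) (y t) u = fun i => lap om u i +
    lap (fun i j => kap i j * (1 - re i j / len (x t) (y t) i j)) u i.
  by apply/funext => i; rewrite /F /force /tension lapDl.
have split (p u : 'I_N -> R) : \sum_i p i * F (x t) (y t) u i =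
   \sum_i p i * lap om u i +
   2^-1 * \sum_i \sum_j kap i j * (1 - re i j / len (x t) (y t) i j) *
     ((u i - u j) * (p i - p j)).
  rewrite -(sum_mul_lap _ _ (g_sym (x t) (y t))) -big_split/=.
  by apply: eq_bigr => i _; rewrite FE mulrDr.
rewrite !split.
set G := fun i j => kap i j * (1 - re i j / len (x t) (y t) i j).
have -> : \sum_i \sum_j 2 * (G i j * ((x t i - x t j) * (px t i - px t j) +
      (y t i - y t j) * (py t i - py t j))) =
    2 * (\sum_i \sum_j G i j * ((x t i - x t j) * (px t i - px t j)) +
         \sum_i \sum_j G i j * ((y t i - y t j) * (py t i - py t j))).
  rewrite -big_split mulr_sumr; apply: eq_bigr => i _.
  by rewrite -big_split mulr_sumr; apply: eq_bigr => j _; rewrite mulrDr.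
by field.
Qed.

Let powerE s : power s = 2^-1 * \sum_i \sum_j
  tension om kap re (len (x s) (y s)) i j *
    ((x s i - x s j) * (px s i - px s j) + (y s i - y s j) * (py s i - py s j)).
Proof.
rewrite /power big_split/= !sum_mul_lap// -mulrDr -big_split/=; congr (_ * _).
apply: eq_bigr => i _; rewrite -big_split/=; apply: eq_bigr => j _.
by rewrite [RHS]mulrDr.
Qed.

(* The Hessian of [k (r - l)^2 / 2] is bounded above by [k], because
   [- k l r] is concave; hence no lower bound on the lengths is needed. *)
Lemma is_derive_power : exists2 dG : R, is_derive t 1 power dG &
  dG <= \sum_i (ax i * F (x t) (y t) (x t) i + ay i * F (x t) (y t) (y t) i)
        + 2 * (\sum_i \sum_j `|om i j + kap i j|) * sqnorm (px t) (py t).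
Proof.
pose dot i j := (x t i - x t j) * (px t i - px t j) +
  (y t i - y t j) * (py t i - py t j).
pose dota i j := (x t i - x t j) * (ax i - ax j) + (y t i - y t j) * (ay i - ay j).
pose sq i j := (px t i - px t j) ^+ 2 + (py t i - py t j) ^+ 2.
pose r i j := len (x t) (y t) i j.
pose hess i j := (om i j + kap i j) * sq i j
  - kap i j * re i j * (sq i j / r i j - dot i j ^+ 2 / r i j ^+ 3).
pose dg i j := tension om kap re r i j * dota i j + hess i j.
have Ddot i j : is_derive t 1 (fun s => (x s i - x s j) * (px s i - px s j) +
    (y s i - y s j) * (py s i - py s j)) (sq i j + dota i j).
  apply: (is_derive_eqfun (is_derive_add
    (is_derive_mul (is_derive_sub (Dx i) (Dx j)) (is_derive_sub (Dpx i) (Dpx j)))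
    (is_derive_mul (is_derive_sub (Dy i) (Dy j)) (is_derive_sub (Dpy i) (Dpy j))))) => //.
  by rewrite /sq /dota; ring.
have Dg i j : is_derive t 1 (fun s => tension om kap re (len (x s) (y s)) i j *
    ((x s i - x s j) * (px s i - px s j) + (y s i - y s j) * (py s i - py s j)))
    (dg i j).
  have [<-|ij] := eqVneq i j.
    apply: (is_derive_eqfun (is_derive_const 0 t)).
      by move=> s; rewrite !subrr !mul0r addr0 mulr0.
    by rewrite /dg /hess /dota /sq /dot !subrr; ring.
  have r0 : 0 < r i j by exact: len_gt0.
  have rN : r i j != 0 by rewrite gt_eqF.
  have D := is_derive_sub (is_derive_scale (om i j + kap i j) (Ddot i j))
    (is_derive_scale (kap i j * re i j) (is_derive_div (Ddot i j) (Dlen ij) rN)).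
  apply: (is_derive_eqfun D).
    by move=> s; rewrite /tension; ring.
  rewrite /dg /hess /tension -/(r i j) -/(dot i j); field; exact: rN.
exists (2^-1 * \sum_i \sum_j dg i j).
  apply: (is_derive_eqfun (is_derive_scale 2^-1 (is_derive_bigsum (fun i _ =>
    is_derive_bigsum (fun j _ => Dg i j))))) => //.
  by move=> s; rewrite powerE.
have -> : \sum_i (ax i * F (x t) (y t) (x t) i + ay i * F (x t) (y t) (y t) i) =
    2^-1 * \sum_i \sum_j tension om kap re r i j * dota i j.
  rewrite big_split/= !sum_mul_lap; [|exact: tension_sym..].
  rewrite -mulrDr -big_split/=; congr (_ * _).
  apply: eq_bigr => i _; rewrite -big_split/=; apply: eq_bigr => j _.
  by rewrite [RHS]mulrDr.
have hess_le i j : hess i j <= `|om i j + kap i j| * (4 * sqnorm (px t) (py t)).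
  have sq0 : 0 <= sq i j by rewrite addr_ge0 ?sqr_ge0.
  apply: (@le_trans _ _ ((om i j + kap i j) * sq i j)); last first.
    apply: (@le_trans _ _ (`|om i j + kap i j| * sq i j)).
      by rewrite ler_wpM2r// ler_norm.
    by rewrite ler_wpM2l// /sq sqnorm_diff.
  rewrite gerBl mulr_ge0//.
    by rewrite mulr_ge0// ?norm2_ge0// ltW.
  have [<-|ij] := eqVneq i j.
    by rewrite /r len_diag invr0 expr0n/= invr0 !mulr0 subrr.
  have r0 : 0 < r i j by exact: len_gt0.
  (* By Lagrange's identity the numerator is the squared cross product of the edge vector and the
     relative velocity. *)
  have -> : sq i j / r i j - dot i j ^+ 2 / r i j ^+ 3 =
      (r i j ^+ 2 * sq i j - dot i j ^+ 2) / r i j ^+ 3.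
    by field; rewrite gt_eqF.
  rewrite divr_ge0 ?exprn_ge0// ?(ltW r0)// sqr_norm2.
  rewrite (_ : _ - _ = ((x t i - x t j) * (py t i - py t j)
      - (y t i - y t j) * (px t i - px t j)) ^+ 2) ?sqr_ge0//.
  by rewrite /sq /dot; ring.
have -> : \sum_i \sum_j dg i j = \sum_i \sum_j tension om kap re r i j * dota i j
    + \sum_i \sum_j hess i j.
  by rewrite -big_split; apply: eq_bigr => i _; rewrite -big_split.
have : \sum_i \sum_j hess i j <=
    \sum_i \sum_j `|om i j + kap i j| * (4 * sqnorm (px t) (py t)).
  by apply: ler_sum => i _; apply: ler_sum => j _.
under [X in _ <= X]eq_bigr do rewrite -mulr_suml.
rewrite -mulr_suml; lra.
Qed.

End AlongCurve.

(** * Lipschitz estimates for the vector field *)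

Section Lipschitz.
Context {R : realType} {N : nat}.
Implicit Types (x y u : 'I_N -> R) (rho : 'I_N -> 'I_N -> R).

(* Only one of the two denominators has to be bounded away from [0]: hence a
   solution near the shape is unique among all solutions in the domain. *)
Lemma quotient_dist (a b A B eps eta delta : R) : 0 < eps -> eps <= A -> 0 < B ->
  `|b| <= B -> `|A - B| <= eta -> `|a - b| <= delta ->
  `|a / A - b / B| <= (delta + eta) / eps.
Proof.
move=> eps0 epsA B0 bB AB ab.
have A0 : 0 < A by exact: lt_le_trans epsA.
have -> : a / A - b / B = ((a - b) - b / B * (A - B)) / A.
  by field; rewrite !gt_eqF.
rewrite normrM normfV (gtr0_norm A0).
apply: ler_pM => //; first by rewrite invr_ge0 ltW.
  apply: (le_trans (ler_normB _ _)); apply: lerD => //.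
  rewrite normrM -[leRHS]mul1r; apply: ler_pM => //.
  by rewrite normrM normfV (gtr0_norm B0) ler_pdivrMr// mul1r.
by rewrite lef_pV2.
Qed.

Lemma len_dist x y x' y' (M : R) : (forall i, `|x i - x' i| <= M) ->
  (forall i, `|y i - y' i| <= M) ->
  forall i j, `|len x y i j - len x' y' i j| <= 4 * M.
Proof.
move=> hx hy i j; apply: (le_trans (norm2_dist _ _ _ _)).
apply: (le_trans (norm2_le_normD _ _)).
have two (u u' : 'I_N -> R) : (forall i, `|u i - u' i| <= M) ->
    `|u i - u j - (u' i - u' j)| <= 2 * M.
  move=> h; rewrite (_ : _ - _ = (u i - u' i) - (u j - u' j)); last by ring.
  apply: (le_trans (ler_normB _ _)); have := h i; have := h j; lra.
have := two _ _ hx; have := two _ _ hy; lra.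
Qed.

Context (om kap re : 'I_N -> 'I_N -> R).
Hypothesis kap_ge0 : forall i j, 0 <= kap i j.
Hypothesis re_ge0 : forall i j, 0 <= re i j.

(** In [6 / eps], [6 = 2 + 4]: a perturbation of size [M] of each coordinate changes coordinate
    differences by [2 M] and lengths by [4 M], as [quotient_dist] requires. *)
Definition force_lip (eps : R) : R :=
  \sum_i \sum_j (2 * `|om i j + kap i j| + kap i j * re i j * (6 / eps)).

Let lip_ge0 eps i j : 0 < eps ->
  0 <= 2 * `|om i j + kap i j| + kap i j * re i j * (6 / eps).
Proof.
move=> e0; apply: addr_ge0; first exact: mulr_ge0.
by apply: mulr_ge0; [exact: mulr_ge0|rewrite divr_ge0// ltW].
Qed.

Lemma force_lip_ge0 eps : 0 < eps -> 0 <= force_lip eps.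
Proof. by move=> e0; apply: sum2_ge0 => i j; exact: lip_ge0. Qed.

Lemma lap_tension_dist (eps M : R) rho rho' u u' : 0 < eps ->
  (forall i j, i != j -> [/\ eps <= rho i j, 0 < rho' i j,
     `|u' i - u' j| <= rho' i j & `|rho i j - rho' i j| <= 4 * M]) ->
  (forall i, `|u i - u' i| <= M) -> forall i,
  `|lap (tension om kap re rho) u i - lap (tension om kap re rho') u' i| <=
    force_lip eps * M.
Proof.
move=> eps0 hrho hu i.
have M0 : 0 <= M by apply: le_trans (hu i).
apply: (@le_trans _ _ (\sum_j (2 * `|om i j + kap i j| + kap i j * re i j * (6 / eps)) * M)).
  rewrite -sumrB; apply: (le_trans (ler_norm_sum _ _ _)); apply: ler_sum => j _.
  have [<-|ij] := eqVneq i j.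
    by rewrite !subrr !mulr0 subrr normr0 mulr_ge0// lip_ge0.
  have [h1 h2 h3 h4] := hrho _ _ ij.
  have uij : `|u i - u j - (u' i - u' j)| <= 2 * M.
    rewrite (_ : _ - _ = (u i - u' i) - (u j - u' j)); last by ring.
    apply: (le_trans (ler_normB _ _)); have := hu i; have := hu j; lra.
  have q := quotient_dist eps0 h1 h2 h3 h4 uij.
  rewrite /tension (_ : _ - _ = (om i j + kap i j) * (u i - u j - (u' i - u' j))
    - kap i j * re i j * ((u i - u j) / rho i j - (u' i - u' j) / rho' i j)); last by ring.
  apply: (le_trans (ler_normB _ _)); rewrite [leRHS]mulrDl; apply: lerD.
    by rewrite normrM -mulrA mulrCA ler_wpM2l.
  rewrite normrM ger0_norm ?mulr_ge0// -[leRHS]mulrA ler_wpM2l ?mulr_ge0//.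
  by apply: (le_trans q); rewrite le_eqVlt; apply/orP; left; apply/eqP; field; rewrite gt_eqF.
rewrite -mulr_suml ler_wpM2r// /force_lip [leRHS](bigD1 i)//= lerDl.
by apply: sumr_ge0 => k _; apply: sumr_ge0 => j _; exact: lip_ge0.
Qed.

(** All coordinates of the phase space in one finite type, positions on the left and momenta on the
    right, to match the [I -> R] of the results on differential equations. *)
Definition phase_index : finType := (('I_N + 'I_N) + ('I_N + 'I_N))%type.
Implicit Types a b : phase_index -> R.

Definition xpos a i := a (inl (inl i)).
Definition ypos a i := a (inl (inr i)).
Definition xmom a i := a (inr (inl i)).
Definition ymom a i := a (inr (inr i)).

(** The length function [rho] is a parameter, so that the true field and the truncated one are
    instances. *)
Definition phase_field (nu : R) (rho : ('I_N -> R) -> ('I_N -> R) -> 'I_N -> 'I_N -> R)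
    a (k : phase_index) : R :=
  let F := lap (tension om kap re (rho (xpos a) (ypos a))) in
  match k with
  | inl (inl i) => xmom a i
  | inl (inr i) => ymom a i
  | inr (inl i) => - nu * xmom a i - F (xpos a) i
  | inr (inr i) => - nu * ymom a i - F (ypos a) i
  end.

Lemma phase_field_dist (nu eps M : R)
    (rho : ('I_N -> R) -> ('I_N -> R) -> 'I_N -> 'I_N -> R) a b : 0 <= nu -> 0 < eps ->
  (forall x y x' y' i j, (forall i, `|x i - x' i| <= M) -> (forall i, `|y i - y' i| <= M) ->
    `|rho x y i j - rho x' y' i j| <= 4 * M) ->
  (forall i j, i != j -> [/\ eps <= rho (xpos a) (ypos a) i j,
     0 < rho (xpos b) (ypos b) i j &
     len (xpos b) (ypos b) i j <= rho (xpos b) (ypos b) i j]) ->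
  (forall k, `|a k - b k| <= M) -> forall k,
  `|phase_field nu rho a k - phase_field nu rho b k| <=
    (1 + nu + force_lip eps) * M.
Proof.
move=> nu0 eps0 rho_lip hrho hab k.
have M0 : 0 <= M by apply: le_trans (hab k).
have L0 := force_lip_ge0 eps0.
have LM : 0 <= force_lip eps * M by rewrite mulr_ge0.
have nM : 0 <= nu * M by rewrite mulr_ge0.
have mom (p p' f f' : R) : `|p - p'| <= M -> `|f - f'| <= force_lip eps * M ->
    `|- nu * p - f - (- nu * p' - f')| <= (1 + nu + force_lip eps) * M.
  move=> hp hf; rewrite (_ : _ - _ = - nu * (p - p') - (f - f')); last by ring.
  apply: (le_trans (ler_normB _ _)); rewrite normrM normrN (ger0_norm nu0).
  have : nu * `|p - p'| <= nu * M by rewrite ler_wpM2l.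
  lra.
have dist (u u' : 'I_N -> R) :
    (forall i, `|u i - u' i| <= M) ->
    (forall i j, `|u' i - u' j| <= len (xpos b) (ypos b) i j) ->
    forall i, `|lap (tension om kap re (rho (xpos a) (ypos a))) u i -
      lap (tension om kap re (rho (xpos b) (ypos b))) u' i| <= force_lip eps * M.
  move=> hu hu'; apply: lap_tension_dist => // i j ij.
  have [h1 h2 h3] := hrho _ _ ij; split=> //; first exact: le_trans h3.
  by apply: rho_lip => m; exact: hab.
have simple (p p' : R) : `|p - p'| <= M -> `|p - p'| <= (1 + nu + force_lip eps) * M.
  lra.
case: k => [[i|i]|[i|i]] /=.
- by apply: simple; exact: hab.
- by apply: simple; exact: hab.
- apply: mom; first exact: hab.
  by apply: dist => [m|m n]; [exact: hab|exact: normr_le_norm2l].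
- apply: mom; first exact: hab.
  by apply: dist => [m|m n]; [exact: hab|exact: normr_le_norm2r].
Qed.

End Lipschitz.

Section Continuity.
Context {R : realType} {N : nat} (xe ye : 'I_N -> R).

Lemma cvg_bigsum (I : finType) (T : Type) (F : set_system T) {FF : Filter F}
    (f : I -> T -> R) (l : I -> R) : (forall i, f i @ F --> l i) ->
  (\sum_i f i s) @[s --> F] --> \sum_i l i.
Proof.
move=> H.
have -> : (fun s => \sum_i f i s) = \sum_i f i.
  by apply/funext => s; rewrite fct_sumE.
elim/big_ind2 : _ => // [|g a h b Hg Hh]; first exact: cvg_cst.
exact: cvgD.
Qed.

Lemma cvg_shape_dist2 (T : Type) (F : set_system T) {FF : Filter F}
    (x y : T -> 'I_N -> R) (x0 y0 : 'I_N -> R) :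
  (forall i, x s i @[s --> F] --> x0 i) -> (forall i, y s i @[s --> F] --> y0 i) ->
  shape_dist2 xe ye (x s) (y s) @[s --> F] --> shape_dist2 xe ye x0 y0.
Proof.
move=> Hx Hy.
have cent (u : T -> 'I_N -> R) u0 : (forall i, u s i @[s --> F] --> u0 i) ->
    forall i, centered (u s) i @[s --> F] --> centered u0 i.
  move=> Hu i; apply: cvgB; first exact: Hu.
  by apply: cvgM; [exact: cvg_bigsum|exact: cvg_cst].
have cx := cent _ _ Hx; have cy := cent _ _ Hy.
have cdot : dotC xe ye (x s) (y s) @[s --> F] --> dotC xe ye x0 y0.
  by apply: cvg_bigsum => i; apply: cvgD; apply: cvgM => //; exact: cvg_cst.
have ccross : crossC xe ye (x s) (y s) @[s --> F] --> crossC xe ye x0 y0.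
  by apply: cvg_bigsum => i; apply: cvgB; apply: cvgM => //; exact: cvg_cst.
apply: cvgB; first apply: cvgD.
- by apply: cvg_bigsum => i; apply: cvgD; apply: cvgM.
- exact: cvg_cst.
apply: cvgM; first exact: cvg_cst.
apply: (cvg_comp (fun s => dotC xe ye (x s) (y s) ^+ 2 + crossC xe ye (x s) (y s) ^+ 2)
  Num.sqrt); last exact: sqrt_continuous.
by apply: cvgD; apply: cvgM.
Qed.

End Continuity.

(** * Exponential decay, trapping and uniqueness in coordinates *)

Section Stability.
Context {R : realType} {N : nat}.
Context (om kap : 'I_N -> 'I_N -> R) (xe ye : 'I_N -> R) (c0 nu : R).
Let re := len xe ye.

Hypothesis N_gt0 : (0 < N)%N.
Hypothesis om_sym : forall i j, om i j = om j i.
Hypothesis om_xe : forall i, lap om xe i = 0.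
Hypothesis om_ye : forall i, lap om ye i = 0.
Hypothesis c0_gt0 : 0 < c0.
Hypothesis om_bound : forall x,
  \sum_i lap om x i ^+ 2 <= c0 * \sum_i x i * lap om x i.
Hypothesis om_ker : forall x, (forall i, lap om x i = 0) ->
  exists a b c : R, forall i, x i = a * xe i + b * ye i + c.
Hypothesis kap_sym : forall i j, kap i j = kap j i.
Hypothesis kap_gt0 : forall i j, 0 < kap i j.
Hypothesis re_gt0 : forall i j, i != j -> 0 < re i j.
Hypothesis noncollinear : exists i j k,
  (xe j - xe i) * (ye k - ye i) - (xe k - xe i) * (ye j - ye i) != 0.
Hypothesis nu_gt0 : 0 < nu.

Notation I := (phase_index (N := N)).

(** The squared Euclidean distance to the equilibrium set, as [dist_shape] confirms. *)
Definition phase_dist2 (a : I -> R) : R :=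
  sqnorm (xmom a) (ymom a) + shape_dist2 xe ye (xpos a) (ypos a).

Let fieldl := phase_field om kap re nu len.

Lemma lyapunov_decay : exists eta rho lam K : R,
  [/\ 0 < eta, 0 < rho, 0 < lam, 1 <= K &
  (forall x y, shape_dist2 xe ye x y <= eta -> forall i j, i != j -> rho <= len x y i j) /\
  forall (z : R -> I -> R) (t : R), 0 <= t ->
    (forall s k, 0 <= s <= t -> is_derive s 1 (z^~ k) (fieldl (z s) k)) ->
    (forall s, 0 <= s <= t -> shape_dist2 xe ye (xpos (z s)) (ypos (z s)) <= eta) ->
    phase_dist2 (z t) <= K * expR (- lam * t) * phase_dist2 (z 0)].
Proof.
have [C1 [C10 HC1]] := force_le_energy xe ye c0_gt0 om_bound kap_gt0.
have [C2 [C20 HC2]] := energy_le_dist om_sym om_xe om_ye c0_gt0 om_bound kap_gt0.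
have [eta [C3 [rho [eta0 C30 rho0 near]]]] := near_shape om_xe om_ye c0_gt0
  om_bound om_ker kap_sym kap_gt0 re_gt0 noncollinear N_gt0.
have U_ge0 := energy_ge0 xe ye c0_gt0 om_bound kap_gt0.
have U_le x y : energy om kap xe ye x y <= C2 * shape_dist2 xe ye x y.
  have [theta [a [b [hx [hy [_ _ _ _ <-]]]]]] := nearest_shape xe ye N_gt0 x y.
  exact/HC2/cos2Dsin2.
pose M := 2 * \sum_i \sum_j `|om i j + kap i j|.
have M0 : 0 <= M by rewrite mulr_ge0// sum2_ge0.
pose nM := nu ^+ 2 + 2 * M + 1.
have nM0 : 0 < nM by rewrite ltr_wpDl// addr_ge0 ?sqr_ge0// mulr_ge0.
(* The first two bounds keep [eps * G] below half of the mechanical energy; the third lets the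
   damping absorb the momentum terms of [eps * dG]. *)
pose eps := Num.min (2^-1) (Num.min C1^-1 (nu / nM)).
have eps0 : 0 < eps by rewrite !lt_min invr_gt0 ltr0n/= invr_gt0 C10 divr_gt0.
have [eps2 epsC1 epsnu] : [/\ eps <= 2^-1, eps * C1 <= 1 & eps * nM <= nu].
  split; first by rewrite ge_min lexx.
    by rewrite -ler_pdivlMr// mul1r !ge_min lexx !orbT.
  by rewrite -ler_pdivlMr// !ge_min lexx !orbT.
have C4 : 0 < 4 * C2 * C3 by rewrite !mulr_gt0.
(* The derivative of [W] is at most [- nu/2 P - eps/2 Q]; the two bounds match [lam * P] with the
   first term and [2 * lam * U <= 2 * lam * C2 * C3 * Q] with the second. *)
pose lam := Num.min (nu / 2) (eps / (4 * C2 * C3)).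
have lam0 : 0 < lam by rewrite lt_min !divr_gt0.
have [lamnu lameps] : lam <= nu / 2 /\ lam * (4 * C2 * C3) <= eps.
  by split; [rewrite ge_min lexx|rewrite -ler_pdivlMr// ge_min lexx orbT].
(* The product of the constants that compare [W] with the squared distance from below and from
   above. *)
pose K := (4 + 2 * C3 * C1) * (1 + 2 * C2).
have C31 : 0 < C3 * C1 by rewrite mulr_gt0.
exists eta, rho, lam, K; split=> //.
  by rewrite -[1]mul1r; apply: ler_pM => //; rewrite -?(mulrA 2); lra.
split=> [x y /near[]//|z t t0 Dz nz].
have weaken s : 0 < s < t -> 0 <= s <= t by case/andP=> ? ?; rewrite !ltW.
pose x s := xpos (z s); pose y s := ypos (z s).
pose px s := xmom (z s); pose py s := ymom (z s).
pose Fx s := force om kap xe ye (x s) (y s) (x s).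
pose Fy s := force om kap xe ye (x s) (y s) (y s).
pose P s := sqnorm (px s) (py s).
pose U s := energy om kap xe ye (x s) (y s).
pose G := power om kap xe ye x y px py.
pose Q s := sqnorm (Fx s) (Fy s).
pose D s := shape_dist2 xe ye (x s) (y s).
have P0 s : 0 <= P s by exact: sqnorm_ge0.
have Q0 s : 0 <= Q s by exact: sqnorm_ge0.
have U0 s : 0 <= U s by exact: U_ge0.
have QU s : Q s <= C1 * U s by exact: HC1.
have UD s : U s <= C2 * D s by exact: U_le.
have DQ s : 0 <= s <= t -> D s <= C3 * Q s by move=> /nz/near[].
(* Used with [c = 1] and [c = -1] for the size of the cross term, and with [c = - nu] for the
   damping in its derivative. *)
have young c s : c * G s <= (c ^+ 2 * P s + Q s) / 2.
  rewrite mulrDl /G /power /P /Q /sqnorm !mulr_sumr !mulr_suml -big_split/=.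
  apply: ler_sum => i _; rewrite -/(Fx s) -/(Fy s).
  have := sqr_ge0 (c * px s i - Fx s i); have := sqr_ge0 (c * py s i - Fy s i).
  by lra.
pose W s := 2^-1 * P s + U s + eps * G s.
have epsG s : `|eps * G s| <= 4^-1 * P s + 2^-1 * U s.
  have h1 := young 1 s; have h2 := young (-1) s.
  have h3 : eps * C1 * U s <= U s by rewrite ler_piMl.
  have h4 : eps * P s <= 2^-1 * P s by rewrite ler_wpM2r.
  have h5 : eps * Q s <= eps * (C1 * U s) by rewrite ler_wpM2l// ltW.
  have h6 : eps * (1 * G s) <= eps * ((1 ^+ 2 * P s + Q s) / 2) by rewrite ler_wpM2l// ltW.
  have h7 : eps * (-1 * G s) <= eps * (((-1) ^+ 2 * P s + Q s) / 2) by rewrite ler_wpM2l// ltW.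
  by rewrite ler_norml; apply/andP; split; lra.
have [WP WU] : (forall s, W s <= P s + 2 * U s) /\
    (forall s, 4^-1 * P s + 2^-1 * U s <= W s).
  split=> s; have := epsG s; rewrite ler_norml /W => /andP[h1 h2];
    have := P0 s; have := U0 s; lra.
have DW s : 0 <= s <= t -> exists2 dW : R, is_derive s 1 W dW & dW <= - lam * W s.
  move=> st.
  have len0 i j : i != j -> 0 < len (x s) (y s) i j.
    by move=> ij; apply: lt_le_trans rho0 _; have [_] := near _ _ (nz s st); apply.
  have Dx i : is_derive s 1 (fun r => x r i) (px s i) by exact: (Dz s (inl (inl i)) st).
  have Dy i : is_derive s 1 (fun r => y r i) (py s i) by exact: (Dz s (inl (inr i)) st).
  have Dpx i : is_derive s 1 (fun r => px r i) (- nu * px s i - Fx s i).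
    exact: (Dz s (inr (inl i)) st).
  have Dpy i : is_derive s 1 (fun r => py r i) (- nu * py s i - Fy s i).
    exact: (Dz s (inr (inr i)) st).
  have [dG DG dG_le] := is_derive_power xe ye om_sym kap_sym kap_gt0 Dx Dy Dpx Dpy len0.
  have DU := is_derive_energy xe ye om_sym kap_sym Dx Dy len0.
  have DP : is_derive s 1 P (- 2 * nu * P s - 2 * G s).
    apply: (is_derive_eqfun (is_derive_bigsum (P := predT) (fun (i : 'I_N) _ =>
      is_derive_add (is_derive_sqr (Dpx i)) (is_derive_sqr (Dpy i))))) => //.
    rewrite /P /G /power /sqnorm !mulr_sumr -sumrB; apply: eq_bigr => i _.
    by rewrite -/(Fx s) -/(Fy s); ring.
  (* The potential energy gains the [G s] that the kinetic energy loses, leaving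
     [- nu * P s + eps * dG]. *)
  exists (2^-1 * (- 2 * nu * P s - 2 * G s) + G s + eps * dG).
    exact: (is_derive_add (is_derive_add (is_derive_scale _ DP) DU) (is_derive_scale _ DG)).
  have dGle : dG <= - nu * G s - Q s + M * P s.
    apply: (le_trans dG_le); rewrite -/M lerD2r.
    rewrite /G /power /Q /sqnorm !mulr_sumr -sumrB; apply: ler_sum => i _.
    by rewrite -/(Fx s) -/(Fy s); lra.
  have h1 := young (- nu) s.
  have h2 : eps * dG <= eps * ((nu ^+ 2 * P s + Q s) / 2 - Q s + M * P s).
    by rewrite ler_pM2l//; move: h1; rewrite sqrrN; lra.
  have h3 : eps * nM * P s <= nu * P s by rewrite ler_wpM2r.
  have h4 : lam * W s <= lam * (P s + 2 * U s) by rewrite ler_pM2l.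
  have h5 : lam * P s <= nu / 2 * P s by rewrite ler_wpM2r.
  have h6 : lam * U s <= lam * (C2 * (C3 * Q s)).
    rewrite ler_pM2l//; apply: (le_trans (UD s)).
    by rewrite ler_pM2l//; exact: DQ.
  have h7 : lam * (4 * C2 * C3) * Q s <= eps * Q s by rewrite ler_wpM2r.
  have h8 : 0 <= eps * P s by rewrite mulr_ge0// ltW.
  by move: h3; rewrite /nM; lra.
have Wdec : W t <= W 0 * expR (- lam * t).
  have /choice[dW DW'] : forall s, exists dW : R, 0 <= s <= t ->
      is_derive s 1 W dW /\ dW <= - lam * W s.
    move=> s; have [st|] := boolP (0 <= s <= t); last by exists 0.
    by have [w h1 h2] := DW s st; exists w.
  apply: (@gronwall _ W dW) => //.
  - by move=> s /weaken/DW'[].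
  - by move=> s /weaken/DW'[].
  - by apply: derivable_within_continuous => s; rewrite in_itv/= => /DW'[[]].
have tt : 0 <= t <= t by rewrite t0 lexx.
have F1 : phase_dist2 (z t) <= (4 + 2 * C3 * C1) * W t.
  apply: (@le_trans _ _ (P t + C3 * (C1 * U t))).
    by rewrite lerD2l; apply: (le_trans (DQ t tt)); rewrite ler_pM2l.
  have h1 : 0 <= C3 * C1 * P t by rewrite mulr_ge0// ltW.
  have h2 : (4 + 2 * C3 * C1) * (4^-1 * P t + 2^-1 * U t) <= (4 + 2 * C3 * C1) * W t.
    by rewrite ler_wpM2l// -mulrA; lra.
  by have := U0 t; lra.
have F2 : W 0 <= (1 + 2 * C2) * phase_dist2 (z 0).
  apply: (le_trans (WP 0)); rewrite /phase_dist2 -/(x 0) -/(y 0) -/(px 0) -/(py 0) -/(P 0) -/(D 0).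
  have D0 : 0 <= D 0 by rewrite -(pmulr_rge0 _ C20) (le_trans (U0 0)).
  have h : 0 <= C2 * P 0 by rewrite mulr_ge0// ltW.
  by have := UD 0; lra.
have K14 : 0 <= 4 + 2 * C3 * C1 by rewrite -mulrA; lra.
apply: (le_trans F1).
have -> : K * expR (- lam * t) * phase_dist2 (z 0) = (4 + 2 * C3 * C1) *
    ((1 + 2 * C2) * phase_dist2 (z 0) * expR (- lam * t)) by rewrite /K; ring.
apply: ler_wpM2l => //; apply: (le_trans Wdec).
by rewrite ler_pM2r ?expR_gt0.
Qed.

Lemma phase_dist2_ge0 a : 0 <= phase_dist2 a.
Proof.
rewrite addr_ge0 ?sqnorm_ge0//.
have [? [? [? [? [? [_ _ <- _ _]]]]]] := nearest_shape xe ye N_gt0 (xpos a) (ypos a).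
exact: sqnorm_ge0.
Qed.

Lemma le_shape_phase_dist2 a : shape_dist2 xe ye (xpos a) (ypos a) <= phase_dist2 a.
Proof. by rewrite lerDr sqnorm_ge0. Qed.

(** The radius [eta / K] leaves room for the factor [K] of the decay estimate: a trajectory within
    [eta] up to time [t] is then strictly within [eta] at [t], which is what [trapping] asks for. *)
Lemma phase_stability : exists delta rho lam K : R,
  [/\ 0 < delta, 0 < rho, 0 < lam, 0 < K &
  forall a0, phase_dist2 a0 < delta ->
  exists z : R -> I -> R, z 0 = a0 /\ forall t : R, 0 <= t ->
    [/\ forall i j, i != j -> rho <= len (xpos (z t)) (ypos (z t)) i j,
        forall k, is_derive t 1 (z^~ k) (fieldl (z t) k) &
        phase_dist2 (z t) <= K * expR (- lam * t) * phase_dist2 a0]].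
Proof.
have [eta [rho [lam [K [eta0 rho0 lam0 K1 [len_ge decay]]]]]] := lyapunov_decay.
have K0 : 0 < K by exact: lt_le_trans K1.
exists (eta / K), rho, lam, K; split=> //; first by rewrite divr_gt0.
move=> a0 a0le.
(* On the region that matters, the truncation [maxr (len x y i j) rho] is
   inactive, and it makes the field globally Lipschitz. *)
pose trunc (x y : 'I_N -> R) i j := Num.max (len x y i j) rho.
pose fieldt := phase_field om kap re nu trunc.
have kap0 i j : 0 <= kap i j by exact: ltW.
have re0 i j : 0 <= re i j by exact: norm2_ge0.
have nu0 := ltW nu_gt0.
have trunc_lip (M : R) x y x' y' i j : (forall i, `|x i - x' i| <= M) ->
    (forall i, `|y i - y' i| <= M) -> `|trunc x y i j - trunc x' y' i j| <= 4 * M.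
  move=> hx hy; have := len_dist hx hy i j; rewrite /trunc.
  move: (len x y i j) (len x' y' i j) => a b.
  rewrite !ler_norml => /andP[h1 h2].
  by case: (leP a rho) => ha; case: (leP b rho) => hb; apply/andP; split; lra.
have lip a b M : (forall k, `|a k - b k| <= M) -> forall k,
    `|fieldt a k - fieldt b k| <= (1 + nu + force_lip om kap re rho) * M.
  move=> hab; apply: (phase_field_dist om kap0 re0 nu0 rho0) => //.
    by move=> *; exact: trunc_lip.
  move=> i j ij; rewrite /trunc; split; first by rewrite le_max lexx orbT.
    by rewrite lt_max rho0 orbT.
  by rewrite le_max lexx.
have L0 : 0 < 1 + nu + force_lip om kap re rho.
  by rewrite ltr_wpDr ?force_lip_ge0// addr_gt0.
have [z [z0 Dz]] := picard a0 L0 lip.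
have agree s : shape_dist2 xe ye (xpos (z s)) (ypos (z s)) <= eta ->
    forall k, fieldt (z s) k = fieldl (z s) k.
  move=> /len_ge hl.
  have E : forall u i, lap (tension om kap re (trunc (xpos (z s)) (ypos (z s)))) u i =
      lap (tension om kap re (len (xpos (z s)) (ypos (z s)))) u i.
    move=> u i; apply: eq_bigr => j _; have [<-|ij] := eqVneq i j.
      by rewrite subrr !mulr0.
    by rewrite /tension /trunc (max_idPl _)// hl.
  by case=> [[i|i]|[i|i]] //=; rewrite E.
have trapped : forall t, 0 <= t -> phase_dist2 (z t) < eta.
  apply: (@trapping _ (fun t => phase_dist2 (z t))).
  - move=> t t0.
    have cz k : z s k @[s --> t] --> z t k.
      exact: (is_derive_continuous (Dz t k t0)).
    apply: cvgD; last by apply: cvg_shape_dist2 => i; exact: cz.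
    by apply: cvg_bigsum => i; apply: cvgD; apply: cvgM; exact: cz.
  - rewrite z0; apply: (lt_le_trans a0le).
    by rewrite ler_pdivrMr// ler_peMr// ltW.
  move=> t t0 ht.
  have hs s : 0 <= s <= t -> shape_dist2 xe ye (xpos (z s)) (ypos (z s)) <= eta.
    by move=> /ht; apply: le_trans; exact: le_shape_phase_dist2.
  apply: (le_lt_trans (decay z t t0 _ hs)).
    by move=> s k st; rewrite -agree ?hs//; apply: Dz; case/andP: st.
  rewrite z0; apply: (@le_lt_trans _ _ (K * phase_dist2 a0)).
    rewrite mulrAC ler_piMr ?mulr_ge0 ?phase_dist2_ge0//; first exact: ltW.
    by rewrite -expR0 ler_expR mulNr oppr_le0 mulr_ge0// ltW.
  by rewrite mulrC -ltr_pdivlMr.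
have hs s : 0 <= s -> shape_dist2 xe ye (xpos (z s)) (ypos (z s)) <= eta.
  by move=> /trapped/ltW; apply: le_trans; exact: le_shape_phase_dist2.
exists z; split=> // t t0; split.
- exact/len_ge/hs.
- by move=> k; rewrite -agree ?hs//; exact: Dz.
- rewrite -z0; apply: (decay z t t0) => [s k /andP[s0 _]|s /andP[s0 _]].
    by rewrite -agree; [exact: Dz|exact: hs].
  exact: hs.
Qed.

Lemma phase_unique (rho t : R) (z w : R -> I -> R) : 0 < rho -> 0 <= t ->
  (forall s i j, 0 <= s <= t -> i != j -> rho <= len (xpos (z s)) (ypos (z s)) i j) ->
  (forall s i j, 0 <= s <= t -> i != j -> 0 < len (xpos (w s)) (ypos (w s)) i j) ->
  (forall k, {within `[0, t], continuous (z^~ k)}) ->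
  (forall k, {within `[0, t], continuous (w^~ k)}) ->
  (forall s k, 0 < s < t -> is_derive s 1 (z^~ k) (fieldl (z s) k)) ->
  (forall s k, 0 < s < t -> is_derive s 1 (w^~ k) (fieldl (w s) k)) ->
  w 0 = z 0 -> w t = z t.
Proof.
move=> rho0 t0 hz hw cz cw Dz Dw w0; apply/funext.
apply: (@ode_unique _ _ z w (fun s => fieldl (z s)) (fun s => fieldl (w s))
  (1 + nu + force_lip om kap re rho)) => //; last by rewrite w0.
(* [phase_field_dist] wants lengths bounded below for its first argument only: hence the exchange,
   which puts [z] first. *)
move=> s M /andP[s0 st] hwz k; rewrite distrC.
have hs : 0 <= s <= t by rewrite !ltW.
apply: (phase_field_dist om _ _ (ltW nu_gt0) rho0) => //.
- by move=> i j; exact: ltW.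
- by move=> i j; exact: norm2_ge0.
- by move=> *; exact: len_dist.
- by move=> i j ij; split=> //; [exact: hz|exact: hw].
- by move=> j; rewrite distrC.
Qed.

End Stability.

(** * States and the designed potential *)

Lemma cvg_colP (R : realType) (N : nat) (T : Type) (F : set_system T) {FF : Filter F}
    (f : T -> 'cV[R]_N) (l : 'cV[R]_N) :
  (forall i, f x i 0 @[x --> F] --> l i 0) -> f @ F --> l.
Proof.
move=> H; apply/cvgrPdist_le => e e0.
have : \forall x \near F, forall i, `|l i 0 - f x i 0| <= e.
  apply: (@filter_forall _ _ (fun i x => `|l i 0 - f x i 0| <= e) F) => i.
  by have /cvgrPdist_le := H i; exact.
apply: filterS => x Hx.
rewrite /Num.Def.normr/= mx_normrE (bigmax_le _ (ltW e0))//= => -[i j] _.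
by rewrite !mxE (ord1 j); exact: Hx.
Qed.

Section StateCoordinates.
Context {R : realType} {N : nat}.
Notation I := (phase_index (N := N)).

Definition coords (z : state R N) (k : I) : R :=
  match k with
  | inl (inl i) => z.1.1.1 i 0
  | inl (inr i) => z.1.1.2 i 0
  | inr (inl i) => z.1.2 i 0
  | inr (inr i) => z.2 i 0
  end.

Definition state_of (a : I -> R) : state R N :=
  ((\col_i xpos a i, \col_i ypos a i), \col_i xmom a i, \col_i ymom a i).

Lemma coordsK : cancel coords state_of.
Proof.
case=> [[[x y] px] py]; congr (_, _, _, _); apply/colP => i; by rewrite mxE.
Qed.

Lemma state_ofK : cancel state_of coords.
Proof. by move=> a; apply/funext => -[[i|i]|[i|i]]; rewrite /coords/= mxE. Qed.

Lemma coords_inj : injective coords.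
Proof. exact: can_inj coordsK. Qed.

Lemma coords_quotient (h : R) (z w : state R N) k :
  coords (h^-1 *: (z - w)) k = h^-1 *: (coords z k - coords w k).
Proof. by case: k => [[i|i]|[i|i]]; rewrite /coords/= !mxE. Qed.

Lemma cvg_coordsP (T : Type) (F : set_system T) {FF : Filter F}
    (f : T -> state R N) (l : state R N) :
  f @ F --> l <-> forall k, coords (f x) k @[x --> F] --> coords l k.
Proof.
split=> [fl k|H].
  have c : continuous (fun z : state R N => coords z k).
    move=> z; case: k => [[i|i]|[i|i]].
    - apply: (@continuous_comp _ _ _ (fun z : state R N => z.1.1.1)
        (fun M : 'cV[R]_N => M i 0)); last exact: coord_continuous.
      apply: (@continuous_comp _ _ _ (fun z : state R N => z.1.1) fst).
        by apply: (@continuous_comp _ _ _ (fun z : state R N => z.1) fst); exact: cvg_fst.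
      exact: cvg_fst.
    - apply: (@continuous_comp _ _ _ (fun z : state R N => z.1.1.2)
        (fun M : 'cV[R]_N => M i 0)); last exact: coord_continuous.
      apply: (@continuous_comp _ _ _ (fun z : state R N => z.1.1) snd).
        by apply: (@continuous_comp _ _ _ (fun z : state R N => z.1) fst); exact: cvg_fst.
      exact: cvg_snd.
    - apply: (@continuous_comp _ _ _ (fun z : state R N => z.1.2)
        (fun M : 'cV[R]_N => M i 0)); last exact: coord_continuous.
      apply: (@continuous_comp _ _ _ (fun z : state R N => z.1) snd); first exact: cvg_fst.
      exact: cvg_snd.
    - apply: (@continuous_comp _ _ _ (fun z : state R N => z.2)
        (fun M : 'cV[R]_N => M i 0)); last exact: coord_continuous.
      exact: cvg_snd.
  exact: (cvg_comp _ _ fl (c l)).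
have -> : f = (fun x => ((f x).1.1.1, (f x).1.1.2, (f x).1.2, (f x).2)).
  by apply/funext => x; case: (f x) => [[[? ?] ?] ?].
case: l H => [[[x y] px] py] H.
have hx : (f v).1.1.1 @[v --> F] --> x by apply: cvg_colP => i; exact: (H (inl (inl i))).
have hy : (f v).1.1.2 @[v --> F] --> y by apply: cvg_colP => i; exact: (H (inl (inr i))).
have hpx : (f v).1.2 @[v --> F] --> px by apply: cvg_colP => i; exact: (H (inr (inl i))).
have hpy : (f v).2 @[v --> F] --> py by apply: cvg_colP => i; exact: (H (inr (inr i))).
have h1 : ((f v).1.1.1, (f v).1.1.2) @[v --> F] --> (x, y) by exact: cvg_pair hx hy.
have h2 : ((f v).1.1.1, (f v).1.1.2, (f v).1.2) @[v --> F] --> (x, y, px).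
  exact: cvg_pair h1 hpx.
exact: cvg_pair h2 hpy.
Qed.

Lemma is_derive_cvg {V : normedModType R} (f : R -> V) (t : R) (df : V) :
  is_derive t 1 f df <-> h^-1 *: (f (h + t) - f t) @[h --> 0^'] --> df.
Proof.
have E : (fun h : R => h^-1 *: (f (h + t) - f t)) =
    (fun h : R => h^-1 *: ((f \o shift t) (h *: 1) - f t)).
  by apply/funext => h; rewrite /= [h *: 1]mulr1.
rewrite E; split=> [[D <-]|H]; first exact: D.
by apply: DeriveDef; [apply/cvg_ex; exists df|exact: cvg_lim].
Qed.

Lemma is_derive_coordsP (z : R -> state R N) (t : R) (dz : state R N) :
  is_derive t 1 z dz <-> forall k, is_derive t 1 (fun s => coords (z s) k) (coords dz k).
Proof.
split=> [/is_derive_cvg/cvg_coordsP H k|H].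
  apply/is_derive_cvg; have := H k.
  by under eq_fun do rewrite coords_quotient.
apply/is_derive_cvg/cvg_coordsP => k; under eq_fun do rewrite coords_quotient.
exact/is_derive_cvg.
Qed.

Lemma right_derivative (z : R -> state R N) (dz : state R N) :
  is_derive (0 : R) 1 z dz -> h^-1 *: (z h - z 0) @[h --> 0^'+] --> dz.
Proof.
move=> /is_derive_cvg H; apply: cvg_dnbhs_at_right.
by move: H; under eq_fun do rewrite addr0.
Qed.

(** A competing solution has only a one-sided derivative at [0]; this supplies the continuity at [0]
    that the uniqueness proof needs. *)
Lemma right_continuous_coords (z : R -> state R N) (dz : state R N) k :
  h^-1 *: (z h - z 0) @[h --> 0^'+] --> dz ->
  coords (z h) k @[h --> 0^'+] --> coords (z 0) k.
Proof.
move=> /cvg_coordsP/(_ k); under eq_fun do rewrite coords_quotient.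
move=> H.
have id0 : h @[h --> 0^'+] --> (0 : R).
  by apply: cvg_at_right_filter; exact: cvg_id.
have C : h * (h^-1 *: (coords (z h) k - coords (z 0) k)) + coords (z 0) k
    @[h --> 0^'+] --> 0 * coords dz k + coords (z 0) k.
  by apply: cvgD; [exact: cvgM|exact: cvg_cst].
rewrite mul0r add0r in C; apply: cvg_trans C; apply: near_eq_cvg.
near=> h.
have h0 : h != 0 by rewrite gt_eqF//; near: h; exact: nbhs_right_gt.
by rewrite /= /GRing.scale/= mulrA divff// mul1r subrK.
Unshelve. all: by end_near. Qed.

End StateCoordinates.

(** * Spring constants, rest lengths and the gradient of the potential *)

Section SpringConstants.
Context {R : realType}.
Implicit Types omega : R.

(* The potential of a spring splits as
   [k (r - l)^2 = omega r^2 + excess (r - r^e)^2 + constant]. *)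
Definition excess omega : R := spring_constant omega - omega.

(** For [omega != 0] it equals [omega / atan omega * (pi - atan omega)], a product of positive
    factors. *)
Lemma excess_gt0 omega : 0 < excess omega.
Proof.
rewrite /excess /spring_constant; have [->|w0] := eqVneq omega 0.
  by rewrite subr0 pi_gt0.
have a_pi : 0 < pi - atan omega.
  by rewrite subr_gt0 (lt_trans (atan_ltpi2 _))// ltr_pdivrMr// ltr_pMr ?pi_gt0// ltr1n.
have a0 : 0 < omega / atan omega.
  move: w0; rewrite neq_lt => /orP[w0|w0].
    have : atan omega < 0 by rewrite -(@atan0 R) lt_atan.
    by move=> a0; rewrite -mulrNN -invrN divr_gt0// oppr_gt0.
  have : 0 < atan omega by rewrite -(@atan0 R) lt_atan.
  by move=> a0'; rewrite divr_gt0.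
have aN : atan omega != 0.
  by apply: contraTneq a0 => ->; rewrite invr0 mulr0 ltxx.
have -> : alpha omega * omega - omega = omega / atan omega * (pi - atan omega).
  by rewrite /alpha; field.
by rewrite mulr_gt0.
Qed.

(** Because [k * atan omega / pi = omega]. It is this choice of [l] that puts the edge in stress
    [omega] at length [re]. *)
Lemma spring_constant_rest_length (re omega : R) :
  spring_constant omega * rest_length re omega = excess omega * re.
Proof.
rewrite /excess /spring_constant /rest_length; have piN : (pi : R) != 0 by rewrite gt_eqF ?pi_gt0.
have [->|w0] := eqVneq omega 0; first by rewrite atan0 mul0r !subr0 mulr1 mulrC.
have aN : atan omega != 0.
  move: w0; rewrite neq_lt => /orP[w0|w0].
    by rewrite lt_eqF// -(@atan0 R) lt_atan.
  by rewrite gt_eqF// -(@atan0 R) lt_atan.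
by rewrite /alpha; move: (pi : R) piN => p piN; field; rewrite aN piN.
Qed.

End SpringConstants.

Lemma sum_lt_sym (R : realType) (N : nat) (f : 'I_N -> 'I_N -> R) :
  (forall i j, f i j = f j i) -> (forall i, f i i = 0) ->
  \sum_(i < N) \sum_(j < N | (i < j)%N) f i j = 2^-1 * \sum_i \sum_j f i j.
Proof.
move=> sym diag.
pose A := \sum_(i < N) \sum_(j < N) (if (i < j)%N then f i j else 0).
have -> : \sum_(i < N) \sum_(j < N | (i < j)%N) f i j = A.
  by apply: eq_bigr => i _; rewrite big_mkcond.
suff -> : \sum_i \sum_j f i j = A + A by field.
have AE : A = \sum_(i < N) \sum_(j < N) (if (j < i)%N then f j i else 0).
  by rewrite /A exchange_big.
rewrite {2}AE -big_split/=; apply: eq_bigr => i _.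
rewrite -big_split/=; apply: eq_bigr => j _.
case: (ltngtP i j) => [_|_|ij]; first by rewrite addr0.
  by rewrite add0r sym.
by rewrite (val_inj ij) diag addr0.
Qed.

Lemma derive_along_line (R : realType) (V : normedModType R) (f : V -> R) (q u : V) (d : R) :
  is_derive (0 : R) 1 (fun h => f (h *: u + q)) d -> 'D_u f q = d.
Proof.
move=> /is_derive_cvg H; apply/cvg_lim => //.
move: H; under eq_fun do rewrite addr0 scale0r add0r.
exact.
Qed.

Section Gradient.
Context {R : realType} {N : nat} (qe : placement R N) (Omega : 'M[R]_N).
Hypothesis Omega_sym : forall i j, Omega i j = Omega j i.

Definition absc (q : placement R N) (i : 'I_N) : R := q.1 i 0.
Definition ordi (q : placement R N) (i : 'I_N) : R := q.2 i 0.

Let om := stress Omega.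
Let kap i j := excess (om i j).
Let xe := absc qe.
Let ye := ordi qe.
Let V := designed_potential qe Omega.

Let tens (q : placement R N) := tension om kap (len xe ye) (len (absc q) (ordi q)).

Let om_sym i j : om i j = om j i. Proof. by rewrite /om /stress Omega_sym. Qed.

Let tens_sym q i j : tens q i j = tens q j i.
Proof. by rewrite /tens /tension /kap om_sym !(len_sym _ _ i). Qed.

(** A spring contributes [k (1 - l / r) = k - (k - omega) re / r], which is [tension] with
    [kap = k - omega]. *)
Lemma derive_designed_potential (q u : placement R N) :
  (forall i j, i != j -> 0 < edge_length q i j) ->
  'D_u V q = \sum_i (u.1 i 0 * lap (tens q) (absc q) i + u.2 i 0 * lap (tens q) (ordi q) i).
Proof.
move=> q0; apply: derive_along_line.
have Dc (w p : 'cV[R]_N) i : is_derive (0 : R) 1 (fun h => (h *: w + p) i 0) (w i 0).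
  have D := is_derive_add (is_derive_mul (is_derive_id (0 : R) (1 : R)) (is_derive_const (w i 0) 0))
     (is_derive_const (p i 0) 0).
  apply: (is_derive_eqfun D) => [h|]; first by rewrite !mxE.
  by rewrite /=; ring.
pose dl i j := (absc q i - absc q j) * (u.1 i 0 - u.1 j 0) +
  (ordi q i - ordi q j) * (u.2 i 0 - u.2 j 0).
have Dedge i j : i != j -> is_derive (0 : R) 1
   (fun h => spring_constant (om i j) * (edge_length (h *: u + q) i j -
      rest_length (edge_length qe i j) (om i j)) ^+ 2) (2 * (tens q i j * dl i j)).
  move=> ij; have len0 : 0 < len (absc q) (ordi q) i j by exact: q0.
  have := @is_derive_norm2 R (fun h => (h *: u.1 + q.1) i 0 - (h *: u.1 + q.1) j 0)
    (fun h => (h *: u.2 + q.2) i 0 - (h *: u.2 + q.2) j 0) 0 _ _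
    (is_derive_sub (Dc u.1 q.1 i) (Dc u.1 q.1 j))
    (is_derive_sub (Dc u.2 q.2 i) (Dc u.2 q.2 j)).
  rewrite !scale0r !add0r => /(_ len0) D.
  have D2 := is_derive_scale (spring_constant (om i j)) (is_derive_sqr (is_derive_sub D
    (is_derive_const (rest_length (edge_length qe i j) (om i j)) 0))).
  apply: (is_derive_eqfun D2) => //.
  cbv beta; rewrite !scale0r !add0r subr0.
  rewrite -/(len (absc q) (ordi q) i j) -/(dl i j).
  have K := spring_constant_rest_length (edge_length qe i j) (om i j).
  have -> : tens q i j = spring_constant (om i j)
      - excess (om i j) * edge_length qe i j / len (absc q) (ordi q) i j.
    rewrite /tens /tension /kap -[len xe ye i j]/(edge_length qe i j) /excess.
    by ring.
  rewrite -K; set r := len _ _ _ _; set l := rest_length _ _.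
  by field; rewrite gt_eqF.
have D := is_derive_scale (2^-1 : R) (is_derive_bigsum (P := predT) (fun (i : 'I_N) _ =>
  is_derive_bigsum (P := fun j : 'I_N => (i < j)%N) (fun j (ij : (i < j)%N) =>
    Dedge i j (negbT (ltn_eqF ij))))).
apply: (is_derive_eqfun D) => //.
rewrite sum_lt_sym; last 2 first.
- move=> i j; rewrite tens_sym /dl; ring.
- by move=> i; rewrite /dl !subrr; ring.
rewrite big_split/= !sum_mul_lap//; try by move=> i j; exact: tens_sym.
rewrite -mulrDr -big_split/= mulrA -[2^-1 * 2^-1]mulrC -mulrA; congr (_ * _).
rewrite mulr_sumr; apply: eq_bigr => i _.
rewrite mulr_sumr -big_split/=; apply: eq_bigr => j _.
by rewrite /dl; field.
Qed.

Lemma coords_damped_field (nu : R) (z : state R N) k : state_domain z ->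
  coords (damped_field nu V z) k =
  phase_field om kap (len xe ye) nu len (coords z) k.
Proof.
case: z => [[q px] py] dom.
have delta (m : 'I_N) (f : 'I_N -> R) : \sum_i (delta_mx m 0 : 'cV[R]_N) i 0 * f i = f m.
  rewrite (bigD1 m)//= mxE !eqxx mul1r big1 ?addr0// => i /negPf im.
  by rewrite mxE im mul0r.
have z0 (f : 'I_N -> R) : \sum_i (0 : 'cV[R]_N) i 0 * f i = 0.
  by rewrite big1// => i _; rewrite mxE mul0r.
case: k => [[i|i]|[i|i]] //=; rewrite mxE.
  rewrite /partial_x derive_designed_potential; last exact: dom.
  by rewrite big_split/= delta z0 addr0.
rewrite /partial_y derive_designed_potential; last exact: dom.
by rewrite big_split/= delta z0 add0r.
Qed.

End Gradient.

Section Stress.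
Context {R : realType} {N : nat} (qe : placement R N).
Context (v : N.-tuple 'cV[R]_N) (d : 'rV[R]_N).
Hypothesis N_gt2 : (2 < N)%N.
Hypothesis basis_v : adapted_basis qe v.
Hypothesis spec_d : admissible_spectrum d.

Let Om := stress_matrix v d.
Let om := stress Om.

(** The rows of [Om] sum to zero, since the constant vector lies in its kernel; so [Om] is the
    Laplacian of its off-diagonal part. *)
Lemma lap_stress (x : 'I_N -> R) i : lap om x i = (Om *m \col_j x j) i 0.
Proof.
have row0 : \sum_j Om i j = 0.
  have : (Om *m const_mx 1 : 'cV[R]_N) i 0 = 0.
    rewrite (stress_matrix_ker_sub N_gt2 basis_v spec_d) ?mxE//.
    by apply: memv_span; rewrite !inE eqxx !orbT.
  rewrite mxE => E; rewrite -[RHS]E.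
  by apply: eq_bigr => j _; rewrite [const_mx _ _ _]mxE mulr1.
rewrite mxE; transitivity (- x i * \sum_j Om i j + \sum_j Om i j * x j).
  rewrite mulr_sumr -big_split/=; apply: eq_bigr => j _; rewrite /om /stress; ring.
by rewrite row0 mulr0 add0r; apply: eq_bigr => j _; congr (_ * _); rewrite mxE.
Qed.

Let col_absc : \col_j absc qe j = qe.1.
Proof. by apply/colP => i; rewrite mxE. Qed.
Let col_ordi : \col_j ordi qe j = qe.2.
Proof. by apply/colP => i; rewrite mxE. Qed.

Lemma lap_stress_absc i : lap om (absc qe) i = 0.
Proof.
rewrite lap_stress col_absc (stress_matrix_ker_sub N_gt2 basis_v spec_d) ?mxE//.
by apply: memv_span; rewrite !inE eqxx.
Qed.

Lemma lap_stress_ordi i : lap om (ordi qe) i = 0.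
Proof.
rewrite lap_stress col_ordi (stress_matrix_ker_sub N_gt2 basis_v spec_d) ?mxE//.
by apply: memv_span; rewrite !inE eqxx orbT.
Qed.

Lemma lap_stress_bound : exists c, 0 < c /\ forall x : 'I_N -> R,
  \sum_i lap om x i ^+ 2 <= c * \sum_i x i * lap om x i.
Proof.
have [c [c0 H]] := stress_matrix_bound basis_v spec_d.
exists c; split=> // x; have := H (\col_j x j).
under eq_bigr do rewrite -lap_stress.
by under [X in _ <= c * X]eq_bigr do rewrite -lap_stress mxE.
Qed.

Lemma lap_stress_ker (x : 'I_N -> R) : (forall i, lap om x i = 0) ->
  exists a b c : R, forall i, x i = a * absc qe i + b * ordi qe i + c.
Proof.
move=> H.
have [|a [b [c E]]] := stress_matrix_ker basis_v spec_d (u := \col_j x j).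
  by apply/colP => i; rewrite -lap_stress H mxE.
by exists a, b, c => i; have := E i; rewrite mxE.
Qed.

Lemma stress_sym i j : om i j = om j i.
Proof. by rewrite /om /stress /Om stress_matrix_sym. Qed.

End Stress.

(** * The shape as a set of states, and the distance to it *)

Section Shape.
Context {R : realType} {N : nat} (qe : placement R N).
Let xe := absc qe.
Let ye := ordi qe.
Let S := rest_states (placement_shape qe).

(** Otherwise every node lies on the line through the first two, which are distinct. *)
Lemma noncollinear_triple : (1 < N)%N -> injective (node qe) -> ~ collinear qe ->
  exists i j k, (xe j - xe i) * (ye k - ye i) - (xe k - xe i) * (ye j - ye i) != 0.
Proof.
move=> N1 inj ncol; apply: contrapT => H; apply: ncol.
pose i0 : 'I_N := Ordinal (ltnW N1); pose j0 : 'I_N := Ordinal N1.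
exists (ye j0 - ye i0), (- (xe j0 - xe i0)),
  ((ye j0 - ye i0) * xe i0 - (xe j0 - xe i0) * ye i0); split.
  apply/eqP => -[y0 x0]; have : i0 = j0.
    apply: inj; congr (_, _).
      by apply/eqP; rewrite eq_sym -subr_eq0 -oppr_eq0; apply/eqP.
    by apply/eqP; rewrite eq_sym -subr_eq0; apply/eqP.
  by move/(congr1 val).
move=> k; apply: contrapT => E; apply: H; exists i0, j0, k.
apply/eqP => D; apply: E; rewrite /=.
by apply/eqP; rewrite -subr_eq0 -oppr_eq0; apply/eqP; rewrite -[RHS]D /xe /ye /absc /ordi; ring.
Qed.

Lemma edge_length_gt0 : injective (node qe) -> forall i j, i != j ->
  0 < len xe ye i j.
Proof.
move=> inj i j ij; rewrite lt_def norm2_ge0 andbT.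
apply: contra ij => /eqP/norm2_eq0[/eqP hx /eqP hy].
apply/eqP/inj; congr (_, _).
  by apply/eqP; rewrite -subr_eq0.
by apply/eqP; rewrite -subr_eq0.
Qed.

Lemma rigid_motionE theta a b i :
  absc (rigid_motion theta a b qe) i = cos theta * xe i + - sin theta * ye i + a /\
  ordi (rigid_motion theta a b qe) i = sin theta * xe i + cos theta * ye i + b.
Proof. by rewrite /absc /ordi /rigid_motion /= !mxE mulNr. Qed.

(** The infimum is attained, at the rigid image given by [nearest_shape]. *)
Lemma dist_shape (z : state R N) : (0 < N)%N ->
  dist z S = Num.sqrt (phase_dist2 xe ye (coords z)).
Proof.
move=> N0.
have normE theta a b : euclidean_norm (z - (rigid_motion theta a b qe, 0, 0)) =
  Num.sqrt (sqnorm (xmom (coords z)) (ymom (coords z)) +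
    sqnorm (fun i => xpos (coords z) i - (cos theta * xe i + - sin theta * ye i + a))
           (fun i => ypos (coords z) i - (sin theta * xe i + cos theta * ye i + b))).
  case: z => [[[x y] px] py]; rewrite /euclidean_norm /sqnorm -big_split/=.
  congr Num.sqrt; apply: eq_bigr => i _.
  rewrite !mxE /xpos /ypos /xmom /ymom /coords /= /xe /ye /absc /ordi.
  by ring.
apply/eqP; rewrite eq_le; apply/andP; split.
  have [theta [a [b [hx [hy [_ _ _ _ E]]]]]] :=
    nearest_shape xe ye N0 (xpos (coords z)) (ypos (coords z)).
  apply: ge_inf.
    by exists 0 => _ [s _ <-]; case: (z - s) => [[[? ?] ?] ?]; exact: sqrtr_ge0.
  exists (rigid_motion theta a b qe, 0, 0); last by rewrite normE E.
  by exists (rigid_motion theta a b qe) => //; exists theta, a, b.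
apply: lb_le_inf.
  exists (euclidean_norm (z - (rigid_motion 0 0 0 qe, 0, 0))).
  exists (rigid_motion 0 0 0 qe, 0, 0) => //.
  by exists (rigid_motion 0 0 0 qe) => //; exists 0, 0, 0.
move=> _ [_ [_ [theta [a [b ->]]] ->] <-].
by rewrite normE ler_wsqrtr// lerD2l shape_dist2_le// cos2Dsin2.
Qed.

End Shape.

Theorem theorem3p4 (R : realType) (N : nat) (qe : placement R N) (nu : R)
    (v : N.-tuple 'cV[R]_N) (d : 'rV[R]_N) :
  (4 <= N)%N ->
  injective (node qe) ->
  ~ collinear qe ->
  0 < nu ->
  adapted_basis qe v ->
  admissible_spectrum d ->
  locally_exponentially_stable_equilibrium_set
    (damped_field nu (designed_potential qe (stress_matrix v d)))
    (rest_states (placement_shape qe)).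
Proof.
move=> N4 inj ncol nu0 basis_v spec_d.
have N3 : (2 < N)%N by exact: leq_trans N4.
have N1 : (1 < N)%N by exact: leq_trans N4.
have N0 : (0 < N)%N by exact: leq_trans N4.
set Om := stress_matrix v d; set f := damped_field _ _.
pose om := stress Om; pose kap i j := excess (om i j).
pose xe := absc qe; pose ye := ordi qe; pose re := len xe ye.
have om_sym := stress_sym v d : forall i j, om i j = om j i.
have om_xe := lap_stress_absc N3 basis_v spec_d : forall i, lap om xe i = 0.
have om_ye := lap_stress_ordi N3 basis_v spec_d : forall i, lap om ye i = 0.
have [c0 [c00 om_bound]] := lap_stress_bound N3 basis_v spec_d.
have om_ker := lap_stress_ker N3 basis_v spec_d.
have kap_sym i j : kap i j = kap j i by rewrite /kap om_sym.
have kap0 i j : 0 < kap i j by exact: excess_gt0.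
have re0 := edge_length_gt0 inj.
have fieldE (z : state R N) k : state_domain z ->
    coords (f z) k = phase_field om kap re nu len (coords z) k.
  by move=> dom; apply: coords_damped_field => // i j; exact: stress_matrix_sym.
split.
  move=> _ [_ [theta [a [b ->]]] ->].
  set q := rigid_motion _ _ _ _.
  have qlen : len (absc q) (ordi q) = re.
    apply/funext => i; apply/funext => j.
    apply: (len_rigid (cos2Dsin2 theta) (a := a) (b := b)) => k.
      by have [-> _] := rigid_motionE qe theta a b k.
    by have [_ ->] := rigid_motionE qe theta a b k.
  have dom : state_domain ((q, 0, 0) : state R N).
    by move=> i j ij; rewrite -[edge_length _ _ _]/(len (absc q) (ordi q) i j) qlen re0.
  (* At the lengths [re] the correction [1 - re / re] vanishes and only the stress remains. *)
  have lapq u : (forall i, lap om u i = 0) -> forall i, lap (tension om kap re re) u i = 0.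
    move=> u0 i; rewrite -[RHS](u0 i); apply: eq_bigr => j _.
    have [<-|ij] := eqVneq i j; first by rewrite subrr !mulr0.
    by rewrite /tension divff ?gt_eqF ?re0// subrr mulr0 addr0.
  split=> //; apply: coords_inj; apply/funext => k; rewrite fieldE//.
  have z0 k' : coords (0 : state R N) k' = 0 by case: k' => [[i|i]|[i|i]]; rewrite /coords/= mxE.
  rewrite z0; case: k => [[i|i]|[i|i]] /=.
  - by rewrite /xmom /coords/= mxE.
  - by rewrite /ymom /coords/= mxE.
  - rewrite [xmom _ _]mxE mulr0 add0r; apply/eqP; rewrite oppr_eq0; apply/eqP.
    rewrite -[len _ _]/(len (absc q) (ordi q)) qlen; apply: lapq => j.
    rewrite -[xpos _]/(absc q).
    have -> : absc q = (fun i => cos theta * xe i + - sin theta * ye i + a).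
      by apply/funext => m; have [-> _] := rigid_motionE qe theta a b m.
    by rewrite lap_linear om_xe om_ye !mulr0 addr0.
  - rewrite [ymom _ _]mxE mulr0 add0r; apply/eqP; rewrite oppr_eq0; apply/eqP.
    rewrite -[len _ _]/(len (absc q) (ordi q)) qlen; apply: lapq => j.
    rewrite -[ypos _]/(ordi q).
    have -> : ordi q = (fun i => sin theta * xe i + cos theta * ye i + b).
      by apply/funext => m; have [_ ->] := rigid_motionE qe theta a b m.
    by rewrite lap_linear om_xe om_ye !mulr0 addr0.
have [delta [rho [lam [K [delta0 rho0 lam0 K0 H]]]]] := phase_stability N0 om_sym
  om_xe om_ye c00 om_bound om_ker kap_sym kap0 re0
  (noncollinear_triple N1 inj ncol) nu0.
(* Square roots, and half the rate, because [phase_stability] is about squared distances. *)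
exists (Num.sqrt delta), (Num.sqrt K), (lam / 2); split.
- by rewrite sqrtr_gt0.
- by rewrite sqrtr_gt0.
- by rewrite divr_gt0.
move=> z0 _; rewrite dist_shape// ltr_sqrt// => /H[a [a0 Ha]].
pose z t := state_of (a t).
have cz t : coords (z t) = a t by exact: state_ofK.
have dom (t : R) : 0 <= t -> state_domain (z t).
  move=> t0 i j ij.
  rewrite -[edge_length _ _ _]/(len (xpos (coords (z t))) (ypos (coords (z t))) i j).
  by have [h _ _] := Ha t t0; rewrite cz (lt_le_trans rho0)// h.
have Dz (t : R) : 0 <= t -> is_derive t 1 z (f (z t)).
  move=> t0; apply/is_derive_coordsP => k; have [_ h _] := Ha t t0.
  rewrite (fieldE _ _ (dom t t0)) cz.
  by rewrite (_ : (fun s => coords (z s) k) = a^~ k)//; apply/funext => s; rewrite cz.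
have zz0 : z 0 = z0 by rewrite /z a0 coordsK.
exists z; split=> //.
- split=> [t t0 _||t t0 _]; first exact: dom.
    by apply: right_derivative; exact: Dz.
  by apply: Dz; exact: ltW.
- move=> T w [wdom w0' Dw] w0 t t0 tT.
  move: t0; rewrite le_eqVlt => /predU1P[<-|t0]; first by rewrite w0 zz0.
  have sT (s : R) : s <= t -> (s%:E < T)%E by move=> st; apply: le_lt_trans tT; rewrite lee_fin.
  have Dwk (s : R) k : 0 < s <= t -> is_derive s 1 (fun s => coords (w s) k)
      (phase_field om kap re nu len (coords (w s)) k).
    move=> /andP[s0 st]; rewrite -fieldE; last by apply: wdom; [exact: ltW|exact: sT].
    by move: k; apply/is_derive_coordsP; apply: Dw; last exact: sT.
  have Da (s : R) k : 0 <= s -> is_derive s 1 (a^~ k) (phase_field om kap re nu len (a s) k).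
    by move=> /Ha[].
  suff E : coords (w t) = a t by rewrite -[LHS]coordsK E.
  apply: (phase_unique kap0 nu0 rho0 (ltW t0) (z := a) (w := fun s => coords (w s))).
  - by move=> s i j /andP[s0 _]; have [h _ _] := Ha s s0; exact: h.
  - move=> s i j /andP[s0 st] ij.
    exact: (wdom s s0 (sT s st) i j ij).
  - move=> k; apply: derivable_within_continuous => s; rewrite in_itv/= => /andP[s0 _].
    by case: (Da s k s0).
  (* At [t < T] the solution [w] is still differentiable from both sides; at [0] only the right
     derivative is available. *)
  - move=> k; apply/continuous_within_itvP => //; split.
    + move=> s; rewrite in_itv/= => /andP[s0 /ltW st].
      by apply: is_derive_continuous; apply: Dwk; rewrite s0 st.
    + exact: right_continuous_coords w0'.
    + apply: cvg_at_left_filter; apply: is_derive_continuous; apply: Dwk.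
      by rewrite t0 lexx.
  - by move=> s k /andP[s0 _]; apply: Da; exact: ltW.
  - by move=> s k /andP[s0 /ltW st]; apply: Dwk; rewrite s0 st.
  - by rewrite w0 a0.
- move=> t t0; have [_ _] := Ha t t0.
  rewrite dist_shape// cz => h.
  have -> : expR (- (lam / 2) * t) = Num.sqrt (expR (- lam * t)).
    rewrite -[LHS]ger0_norm ?expR_ge0// -sqrtr_sqr expr2 -expRD; congr (Num.sqrt (expR _)).
    by field.
  rewrite -!sqrtrM ?mulr_ge0 ?expR_ge0 ?(ltW K0)//.
  exact: ler_wsqrtr.
Qed.
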